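(* Let $n\geq 0$, let $X$ be a space, $y_0\in X$, $\{x_j\}_{j\in\mathbb{N}}$ a sequence in $X$, and let each based space $(A_j,a_j)$ be sequentially $n$-connected. Let $Y=\operatorname{\bf Adj}(X,x_j,A_j,a_j)$ and let $r:Y\to X$ be the canonical retraction. Then every sequence $\{f_m\}_{m\in\mathbb{N}}$ in $\Omega^n(Y,y_0)$ that converges to $y_0$ is sequentially homotopic to $\{r\circ f_m\}_{m\in\mathbb{N}}$. Moreover, if $X$ is sequentially $n$-connected at $y_0$, then $Y$ is sequentially $n$-connected at $y_0$.
   Context: All spaces Hausdorff. $\Omega^n(Y,y_0)$ is the set of maps $(I^n,\partial I^n)\to(Y,y_0)$. A family of maps $\{f_m\}$ into $Y$ converges to $y$ if for every neighborhood $U$ of $y$, $\operatorname{Im}(f_m)\subseteq U$ for all but finitely many $m$. Two sequences $\{f_m\},\{g_m\}$ of maps $Z\to Y$ converging to $y_0$ are sequentially homotopic if there are (free) homotopies $H_m:Z\times I\to Y$ from $f_m$ to $g_m$ such that $\{H_m\}$ converges to $y_0$. $\operatorname{\bf Adj}(X,x_j,A_j,a_j)$: $Y_k$ is the adjunction space from $X\sqcup A_1\sqcup\dots\sqcup A_k$ with $a_j\sim x_j$ ($j\le k$), $Y_{k+1}\to Y_k$ collapses $A_{k+1}$ to $x_{k+1}$, and the space is $\varprojlim_kY_k\subseteq\prod_kY_k$, with underlying set $(X\sqcup\coprod_j A_j)/(a_j\sim x_j)$; $r$ collapses each $A_j$ to $x_j$. $\mathbb{H}_0=\{0\}\cup\{1/m:m\in\mathbb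 N\}$ based at $0$; for $k\ge1$, $\mathbb{H}_k$ is the shrinking wedge of countably many $k$-spheres (one-point union at basepoints, where a set containing the wedge point is open iff it is open in each sphere and contains all but finitely many spheres). A space is sequentially $n$-connected at $x$ if the set of based homotopy classes $[(\mathbb{H}_k,b_0),(X,x)]$ is a singleton for all $0\le k\le n$; a based space $(A,a)$ is sequentially $n$-connected if $A$ is so at $a$. *)

(* Defs.v *)
From HB Require Import structures.
From mathcomp Require Import all_boot all_order all_algebra generic_quotient.
From mathcomp Require Import all_classical all_reals.
From mathcomp Require Import topology wedge_sigT.
From mathcomp Require Import Rstruct Rstruct_topology.

Unset Strict Implicit.
Unset Printing Implicit Defensive.

Import Order.TTheory GRing.Theory Num.Theory.
Local Open Scope classical_set_scope.
Local Open Scope ring_scope.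
Local Open Scope quotient_scope.


Definition RR := Rdefinitions.R.

Definition I01 : topologicalType := set_type (`[0, 1]%classic : set RR).

Definition cube (n : nat) : topologicalType :=
  prod_topology (fun _ : 'I_n => I01).

Definition cube_boundary (n : nat) : set (cube n) :=
  [set z | exists i : 'I_n, set_val (z i) = 0 \/ set_val (z i) = 1].

Definition Omega (n : nat) (Y : topologicalType) (y0 : Y) : set (cube n -> Y) :=
  [set f | continuous f /\ f @` cube_boundary n `<=` [set y0]].

Definition maps_converge_to {Z Y : topologicalType} (f : nat -> Z -> Y) (y : Y) :=
  forall U : set Y, nbhs y U -> finite_set [set m | ~ (range (f m) `<=` U)].

Definition seq_homotopic {Z Y : topologicalType} (f g : nat -> Z -> Y) (y0 : Y) :=
  exists H : nat -> (Z * I01)%type -> Y,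
    (forall m, continuous (H m)) /\
    (forall m z (t : I01), set_val t = 0 -> H m (z, t) = f m z) /\
    (forall m z (t : I01), set_val t = 1 -> H m (z, t) = g m z) /\
    maps_converge_to H y0.

Definition sphere_set (k : nat) : set 'rV[RR]_k.+1 :=
  [set v | \sum_(i < k.+1) v ord0 i ^+ 2 = 1].

Definition sphere (k : nat) : topologicalType := set_type (sphere_set k).

Definition sphere_base_vec (k : nat) : 'rV[RR]_k.+1 :=
  \row_(i < k.+1) (i == ord0)%:R.

Lemma sphere_base_in (k : nat) : sphere_base_vec k \in sphere_set k.
Proof.
apply/mem_set; rewrite /sphere_set /= (bigD1 ord0) //= big1.
  by rewrite mxE eqxx expr1n addr0.
by move=> i /negbTE Hi; rewrite mxE Hi expr0n.
Qed.

Definition sphere_base (k : nat) : sphere k :=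
  @exist _ (fun v => v \in sphere_set k) _ (sphere_base_in k).

Definition swedge_carrier (k : nat) : Type :=
  @wedge nat (fun _ : nat => sphere k) (fun _ => sphere_base k).
HB.instance Definition _ k := Choice.on (swedge_carrier k).

Definition swedge_lift (k : nat) (m : nat) : sphere k -> swedge_carrier k :=
  @wedge_lift _ (fun _ : nat => sphere k) (fun _ => sphere_base k) m.

Definition swedge_pt (k : nat) : swedge_carrier k := swedge_lift k 0 (sphere_base k).

Definition swedge_open (k : nat) (U : set (swedge_carrier k)) : Prop :=
  (forall m, open (swedge_lift k m @^-1` U)) /\
  (U (swedge_pt k) -> finite_set [set m | ~ (range (swedge_lift k m) `<=` U)]).

Lemma swedge_openT k : swedge_open k [set: swedge_carrier k].
Proof.
split=> [m|_]; first by rewrite preimage_setT; exact: openT.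
apply: (@sub_finite_set _ _ set0) => // m /= H; exact: H.
Qed.

Lemma swedge_openI k (U V : set (swedge_carrier k)) :
  swedge_open k U -> swedge_open k V -> swedge_open k (U `&` V).
Proof.
move=> [oU fU] [oV fV]; split=> [m|[Up Vp]].
  by rewrite preimage_setI; apply: openI.
apply: (@sub_finite_set _ _ (_ `|` _)); last first.
  by rewrite finite_setU; exact: (conj (fU Up) (fV Vp)).
move=> m /= H; apply/not_andP => -[HU HV]; apply: H => y [z _ <-].
by split; [apply: HU; exists z|apply: HV; exists z].
Qed.

Lemma swedge_open_bigU k (I : Type) (f : I -> set (swedge_carrier k)) :
  (forall i, swedge_open k (f i)) -> swedge_open k (\bigcup_i f i).
Proof.
move=> hof; split=> [m|[i _ fip]].
  rewrite preimage_bigcup; apply: bigcup_open => i _; exact: (hof i).1.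
apply: (sub_finite_set _ ((hof i).2 fip)) => m /= H Hi; apply: H => y Hy.
by exists i => //; apply: Hi.
Qed.

Definition shrinking_wedge (k : nat) : Type := swedge_carrier k.
HB.instance Definition _ k := Choice.on (shrinking_wedge k).
HB.instance Definition _ k := @isOpenTopological.Build (shrinking_wedge k)
  (@swedge_open k) (@swedge_openT k) (@swedge_openI k) (@swedge_open_bigU k).

Definition H0_set : set RR := [set x | x = 0 \/ exists m : nat, x = (m.+1%:R)^-1].
Definition H0 : topologicalType := set_type H0_set.
Lemma H0_base_in : (0 : RR) \in H0_set.
Proof. by apply/mem_set; left. Qed.
Definition H0_base : H0 := @exist _ (fun v => v \in H0_set) _ H0_base_in.

Definition Hk (k : nat) : topologicalType :=
  match k with 0 => H0 | k'.+1 => shrinking_wedge k'.+1 end.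

Definition Hk_base (k : nat) : Hk k :=
  match k return Hk k with 0 => H0_base | k'.+1 => swedge_pt k'.+1 end.

Definition based_maps {K X : topologicalType} (b : K) (x : X) : set (K -> X) :=
  [set f | continuous f /\ f b = x].

Definition based_homotopic {K X : topologicalType} (b : K) (x : X) (f g : K -> X) :=
  exists H : (K * I01)%type -> X, continuous H /\
    (forall z (t : I01), set_val t = 0 -> H (z, t) = f z) /\
    (forall z (t : I01), set_val t = 1 -> H (z, t) = g z) /\
    (forall t : I01, H (b, t) = x).

Definition based_htpy_classes {K X : topologicalType} (b : K) (x : X) :
    set (set (K -> X)) :=
  [set [set g | based_maps b x g /\ based_homotopic b x f g] | f in based_maps b x].

Definition seq_n_connected_at (X : topologicalType) (x : X) (n : nat) : Prop :=
  forall k, (k <= n)%N -> exists C, based_htpy_classes (Hk_base k) x = [set C].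

Section Adjunction.
Variables (X : topologicalType) (x : nat -> X)
          (A : nat -> topologicalType) (a : forall j, A j).

(** summands of [X ⊔ A_0 ⊔ ... ⊔ A_{k-1}] (indices [j] start at 0 here) *)
Definition adjk_fam (k : nat) (o : option 'I_k) : topologicalType :=
  match o with None => X | Some j => A (nat_of_ord j) end.

Definition adjk_sum (k : nat) : topologicalType := {o : option 'I_k & adjk_fam k o}.

Definition adjk_norm (k : nat) (p : adjk_sum k) : adjk_sum k :=
  match p with
  | existT o y =>
    match o return adjk_fam k o -> adjk_sum k with
    | None => fun y => existT (adjk_fam k) None y
    | Some j => fun y => if y == a (nat_of_ord j)
                         then existT (adjk_fam k) None (x (nat_of_ord j))
                         else existT (adjk_fam k) (Some j) y
    end y
  end.

Definition adjk_rel' (k : nat) (p q : adjk_sum k) := adjk_norm k p == adjk_norm k q.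

Lemma adjk_rel_refl k : reflexive (@adjk_rel' k).
Proof. by move=> p; rewrite /adjk_rel' eqxx. Qed.
Lemma adjk_rel_sym k : symmetric (@adjk_rel' k).
Proof. by move=> p q; rewrite /adjk_rel' eq_sym. Qed.
Lemma adjk_rel_trans k : transitive (@adjk_rel' k).
Proof. by move=> q p s; rewrite /adjk_rel' => /eqP -> /eqP ->. Qed.

Definition adjk_rel k := EquivRel (@adjk_rel' k)
  (@adjk_rel_refl k) (@adjk_rel_sym k) (@adjk_rel_trans k).

Definition Yk (k : nat) : Type := quotient_topology {eq_quot (adjk_rel k)}.
Definition Ytop (k : nat) : topologicalType := Yk k.

Definition adj_fam (o : option nat) : topologicalType :=
  match o with None => X | Some j => A j end.

Definition adj_sum : Type := {o : option nat & adj_fam o}.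

Definition adj_norm (p : adj_sum) : adj_sum :=
  match p with
  | existT o y =>
    match o return adj_fam o -> adj_sum with
    | None => fun y => existT adj_fam None y
    | Some j => fun y => if y == a j then existT adj_fam None (x j)
                         else existT adj_fam (Some j) y
    end y
  end.

Definition adj_rel' (p q : adj_sum) := adj_norm p == adj_norm q.
Lemma adj_rel_refl : reflexive adj_rel'.
Proof. by move=> p; rewrite /adj_rel' eqxx. Qed.
Lemma adj_rel_sym : symmetric adj_rel'.
Proof. by move=> p q; rewrite /adj_rel' eq_sym. Qed.
Lemma adj_rel_trans : transitive adj_rel'.
Proof. by move=> q p s; rewrite /adj_rel' => /eqP -> /eqP ->. Qed.
Definition adj_rel := EquivRel adj_rel' adj_rel_refl adj_rel_sym adj_rel_trans.

Definition adj_set : Type := {eq_quot adj_rel}.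
HB.instance Definition _ := Quotient.on adj_set.
HB.instance Definition _ := Choice.on adj_set.

Definition adj_to_k (k : nat) (p : adj_sum) : adjk_sum k :=
  match p with
  | existT o y =>
    match o return adj_fam o -> adjk_sum k with
    | None => fun y => existT (adjk_fam k) None y
    | Some j => fun y =>
        (if (j < k)%N as b return (j < k)%N = b -> adjk_sum k
         then fun H => existT (adjk_fam k) (Some (Ordinal H)) y
         else fun _ => existT (adjk_fam k) None (x j)) (erefl (j < k)%N)
    end y
  end.

(** the map [adj_set -> ∏_k Y_k], a bijection onto [lim_k Y_k] *)
Definition adj_to_prod (c : adj_set) : prod_topology Ytop :=
  fun k => \pi_(Yk k) (adj_to_k k (repr c)).

(** [Adj(X, x_j, A_j, a_j)]: the set [(X ⊔ ∐ A_j)/(a_j ~ x_j)] carrying the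
    topology of [lim_k Y_k ⊆ ∏_k Y_k] (initial topology of [adj_to_prod]). *)
Definition Adj : Type := adj_set.
HB.instance Definition _ := Choice.on Adj.
HB.instance Definition _ :=
  Topological.copy Adj (@initial_topology adj_set (prod_topology Ytop) adj_to_prod).

Definition adj_incl (y : X) : Adj := \pi_adj_set (existT adj_fam None y).

Definition adj_retr_sum (p : adj_sum) : X :=
  match p with
  | existT o y =>
    match o return adj_fam o -> X with
    | None => fun y => y
    | Some j => fun _ => x j
    end y
  end.

Definition adj_retr (c : Adj) : X := adj_retr_sum (repr c).

End Adjunction.

(* Main.v *)
Require Import Defs.
From HB Require Import structures.
From mathcomp Require Import all_boot all_order all_algebra generic_quotient.
From mathcomp Require Import all_classical all_reals.
From mathcomp Require Import topology normedtype wedge_sigT.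
From mathcomp Require Import Rstruct Rstruct_topology.
From mathcomp Require Import ring lra zify.

(** The retraction [r] and the maps [q_j] collapsing everything except [A_j]
    embed the adjunction space in the product of [X] and all the [A_j]. Hence a
    sequence of maps into it is deformed to its composition with [r] as soon as
    each coordinate sequence [g_m = q_j \o f_m] has null-homotopies that converge
    to [a_j] and are stationary wherever [g_m] takes the value [a_j].

    To build these, decompose the open set where [g_m <> a] into dyadic cells: the
    cell of [z] has the least scale at which all dyadic cubes containing [z] lie
    in the open set. The closed cells accumulate only where [g_m = a] or at
    infinity, so the restrictions of all the [g_m] to all the cells form, up to
    enumeration, one sequence of maps converging to [a]. The null-homotopy is
    extended over the cells by induction on their dimension [d], and one
    application of the triviality of [[H_d, A]] fills all the cells of dimension
    [d] at once. Doing the induction by dimension rather than by scale is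
    essential: only finitely many applications of the hypothesis are needed, and
    the space [A] need not be first countable.

    For the second statement, the same argument is applied to maps on shrinking
    wedges, a sphere minus its base point being identified with [R^k] by
    stereographic projection. *)

Import Order.TTheory GRing.Theory Num.Theory.
Import numFieldNormedType.Exports.
Local Open Scope classical_set_scope.
Local Open Scope ring_scope.

(** * Dyadic cells of an open subset of R^n *)

Section FloorCeil.
Context {R : realType}.
Implicit Types x y : R.

(** Stationarity where [g_m = a_j] lets all coordinates be contracted independently: a point of the
    adjunction space has at most one coordinate off its base point, and a tuple of deformed
    coordinates comes from a point again only if the other ones stay put. It also forces the
    homotopy to be built on the open set where [g_m <> a_j], near whose boundary only convergence of
    sequences is available. Cells of varying scale do not meet face to face, as a face of a large
    cell may be subdivided by smaller ones. The induction survives because subdivision never raises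
    dimension: a point of a closed cell lies either in the same open cell or in a cell of smaller
    dimension. The prism over a [d]-cell is a [(d+1)]-cube; on its boundary, a [d]-sphere, the
    homotopy is already prescribed: [g_m] at the bottom, [a_j] at the top, earlier stages on the
    sides. The constant top face supplies the base point, which is why based classes on shrinking
    wedges suffice. Time is a real number, and the homotopy is constant in time before [0] and after
    [1]. *)

Definition between_floor_ceil x y :=
  (Num.floor x)%:~R <= y /\ y <= (Num.ceil x)%:~R.

Lemma between_floor_ceil_refl x : between_floor_ceil x x.
Proof. by split; [exact: floor_le|exact: ceil_ge]. Qed.

Lemma between_floor_ceil_le x y : between_floor_ceil x y ->
  (Num.floor x <= Num.floor y)%R /\ (Num.ceil y <= Num.ceil x)%R.
Proof. by move=> [h1 h2]; rewrite floor_ge_int ceil_le_int. Qed.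

(** An integer times [2 ^ k] is an integer, so coarse grid points are fine grid points and the fine
    closed cell lies in the coarse one. *)
Lemma between_floor_ceil_coarser x y k :
  between_floor_ceil (2 ^+ k * x) (2 ^+ k * y) -> between_floor_ceil x y.
Proof.
have k0 : (0 : R) < 2 ^+ k by rewrite exprn_gt0.
have e (z : int) : (2 ^+ k * z%:~R : R) = (2 ^+ k * z)%:~R.
  by rewrite intrM rmorphXn.
move=> [h1 h2]; split.
  rewrite -(ler_pM2l k0) (le_trans _ h1)// e ler_int floor_ge_int -e.
  by rewrite ler_pM2l// floor_le.
rewrite -(ler_pM2l k0) (le_trans h2)// e ler_int ceil_le_int -e.
by rewrite ler_pM2l// ceil_ge.
Qed.

(** Floor is upper and ceiling lower semicontinuous, so no nearby [y] has a closed cell that misses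
    [x]. *)
Lemma near_between_floor_ceil x : \forall y \near x, between_floor_ceil y x.
Proof.
have h1 : \forall y \near x, y < (Num.floor x + 1)%:~R.
  by apply: lt_nbhsl; exact: floorD1_gt.
have h2 : \forall y \near x, (Num.ceil x - 1)%:~R < y.
  by apply: lt_nbhsr; exact: ceilB1_lt.
near=> y; split.
  have : y < (Num.floor x + 1)%:~R by near: y.
  rewrite -floor_lt_int ltzD1 => h.
  by rewrite (le_trans _ (floor_le x))// ler_int.
have : (Num.ceil x - 1)%:~R < y by near: y.
rewrite -ceil_gt_int => h.
rewrite (le_trans (ceil_ge x))// ler_int.
by move: h; rewrite ltrBlDr ltzD1.
Unshelve. all: by end_near. Qed.

Lemma floor_eq_ceil x : (Num.floor x == Num.ceil x) = (x \is a Num.int).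
Proof.
by rewrite ceil_floor -{1}[Num.floor x]addr0 (inj_eq (addrI _)); case: (_ \is a _).
Qed.

Lemma between_floor_ceil_int x y : between_floor_ceil x y ->
  x \is a Num.int -> y = x.
Proof.
rewrite /between_floor_ceil => -[+ +] xi; rewrite ceilK// floorK// => h1 h2.
by apply/eqP; rewrite eq_le h1 h2.
Qed.

Lemma between_floor_ceil_nint x y : between_floor_ceil x y ->
  y \isn't a Num.int -> Num.floor y = Num.floor x /\ Num.ceil y = Num.ceil x.
Proof.
move=> /between_floor_ceil_le[].
rewrite !ceil_floor => le1 + yN; rewrite yN.
case: (x \is a Num.int) => /= le2.
  by have := le_trans le2 (lerD le1 (lexx 0)); rewrite lerD2l.
by have /eqP -> : Num.floor y == Num.floor x by rewrite eq_le le1 -(lerD2r 1) le2.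
Qed.

End FloorCeil.

Section DyadicCells.
Context {R : realType} {n : nat}.
Local Notation V := 'rV[R]_n.
Implicit Types (z w y : V) (s : nat) (c : {ffun 'I_n -> int * int}) (O : set V).

(** Floor and ceiling agree exactly in the directions where [z] sits on the grid of side [2 ^- s],
    so the code determines the open face of the dyadic subdivision that contains [z]. *)
Definition cell_code s z : {ffun 'I_n -> int * int} :=
  [ffun i => (Num.floor (2 ^+ s * z ord0 i), Num.ceil (2 ^+ s * z ord0 i))].

Definition closed_cell s c : set V :=
  [set y | forall i, (c i).1%:~R <= 2 ^+ s * y ord0 i <= (c i).2%:~R].

(* When [c = cell_code s z], this is the union of the closed dyadic cubes of
   side [2 ^- s] containing [z]. *)
Definition cell_star s c : set V :=
  [set y | forall i, (c i).2%:~R - 1 <= 2 ^+ s * y ord0 i <= (c i).1%:~R + 1].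

Definition cell_dirs c : {set 'I_n} := [set i | (c i).1 != (c i).2].
Definition cell_dim c := #|cell_dirs c|.

Definition star_in O s z := cell_star s (cell_code s z) `<=` O.

(** For open [O] the default [0] is taken only off [O]; on [O], [levelP] provides a scale. *)
Definition level O z : nat :=
  match pselect (exists s, `[< star_in O s z >]) with
  | left h => ex_minn h
  | right _ => 0%N
  end.

Definition cell_at O z := cell_code (level O z) z.

Lemma closed_cell_codeP s z y :
  closed_cell s (cell_code s z) y <->
  forall i, between_floor_ceil (2 ^+ s * z ord0 i) (2 ^+ s * y ord0 i).
Proof.
split=> h i; first by have := h i; rewrite ffunE /= => /andP[].
by have [h1 h2] := h i; rewrite ffunE /= h1.
Qed.

Lemma closed_cell_code s z : closed_cell s (cell_code s z) z.
Proof. by apply/closed_cell_codeP => i; exact: between_floor_ceil_refl. Qed.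

Lemma cell_star_code s z : cell_star s (cell_code s z) z.
Proof.
move=> i; rewrite ffunE/=; apply/andP; split.
  by have := ceilB1_lt (2 ^+ s * z ord0 i); rewrite intrB => /ltW.
by have := floorD1_gt (2 ^+ s * z ord0 i); rewrite intrD => /ltW.
Qed.

Lemma closed_cell_sub_star s z :
  closed_cell s (cell_code s z) `<=` cell_star s (cell_code s z).
Proof.
move=> y /closed_cell_codeP h i; have [h1 h2] := h i; rewrite ffunE/=.
have hf : (Num.ceil (2 ^+ s * z ord0 i) <= Num.floor (2 ^+ s * z ord0 i) + 1)%R.
  by rewrite ceil_floor lerD2l; case: (_ \is a _).
move: hf; rewrite -(ler_int R) intrD => hf; apply/andP; split.
  by rewrite lerBlDr (le_trans hf)// lerD2r.
by rewrite (le_trans h2).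
Qed.

Lemma closed_cell_coarser s s' z y : (s' <= s)%N ->
  closed_cell s (cell_code s z) y -> closed_cell s' (cell_code s' z) y.
Proof.
move=> /subnK <- /closed_cell_codeP h; apply/closed_cell_codeP => i.
apply: (@between_floor_ceil_coarser _ _ _ (s - s')).
by have := h i; rewrite exprD -!mulrA.
Qed.

(** A dyadic cube containing [z] contains its whole closed cell, hence [y]; so every cube of the
    star of [z] is also one of the star of [y]. *)
Lemma cell_star_anti s z y : closed_cell s (cell_code s z) y ->
  cell_star s (cell_code s z) `<=` cell_star s (cell_code s y).
Proof.
move=> /closed_cell_codeP h w hw i; have := hw i; rewrite !ffunE/=.
have [h1 h2] := between_floor_ceil_le _ _ (h i).
move=> /andP[w1 w2]; rewrite (le_trans _ w1)/= ?(le_trans w2)//.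
  by rewrite lerD2r ler_int.
by rewrite lerD2r ler_int.
Qed.

Lemma near_closed_cell s z : \forall w \near z, closed_cell s (cell_code s w) z.
Proof.
suff h i : \forall w \near z,
    between_floor_ceil (2 ^+ s * (w : V) ord0 i) (2 ^+ s * z ord0 i).
  by apply: filterS (filter_forall _ h) => w hw; apply/closed_cell_codeP.
have c : (fun w : V => 2 ^+ s * w ord0 i) @ z --> 2 ^+ s * z ord0 i.
  by apply: (@cvgM R _ (nbhs z)); [exact: cvg_cst|exact: coord_continuous].
exact: (c _ (near_between_floor_ceil _)).
Qed.

(** The directions of a cell are the coordinates off the grid. Refining the grid, or moving to a
    point of the closed cell, can only lose some; if none is lost, [z] is interior to the cell of
    [w] in each of its directions. *)
Lemma closed_cell_dim s s' w z : (s <= s')%N ->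
  closed_cell s (cell_code s w) z ->
  (cell_dim (cell_code s' z) < cell_dim (cell_code s w))%N \/
  cell_code s z = cell_code s w.
Proof.
move=> ss' /closed_cell_codeP h.
have dirsE t x i : (i \in cell_dirs (cell_code t x)) =
    (2 ^+ t * x ord0 i \isn't a Num.int) by rewrite inE ffunE/= floor_eq_ceil.
have sub1 : cell_dirs (cell_code s' z) \subset cell_dirs (cell_code s z).
  apply/fintype.subsetP => i; rewrite !dirsE; apply: contra => zi.
  by rewrite -(subnK ss') exprD -mulrA rpredM// rpredX// rpred_nat.
have sub2 : cell_dirs (cell_code s z) \subset cell_dirs (cell_code s w).
  apply/fintype.subsetP => i; rewrite !dirsE; apply: contra => wi.
  by rewrite (between_floor_ceil_int _ _ (h i) wi).
have [lt|ge] := ltnP (cell_dim (cell_code s' z)) (cell_dim (cell_code s w)).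
  by left.
right.
have /eqP e : cell_dirs (cell_code s z) == cell_dirs (cell_code s w).
  by rewrite eqEcard sub2/= (leq_trans ge)// subset_leq_card.
apply/ffunP => i; rewrite !ffunE.
have := dirsE s z i; rewrite e dirsE; case: (boolP (_ \is a Num.int)) => /= wi.
  by move=> _; rewrite (between_floor_ceil_int _ _ (h i) wi).
by move=> /esym zi; have [-> ->] := between_floor_ceil_nint _ _ (h i) zi.
Qed.

Lemma level_le O s z : star_in O s z -> (level O z <= s)%N.
Proof.
move=> h; rewrite /level; case: pselect => [e|[]]; last by exists s; apply/asboolP.
by case: ex_minnP => m _; apply; apply/asboolP.
Qed.

Lemma closed_star_small e : 0 < e -> exists s, forall z y,
  cell_star s (cell_code s z) y -> forall i, `|z ord0 i - y ord0 i| < e.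
Proof.
move=> e0; pose s := Num.truncn (e^-1); exists s => z y h i.
have s0 : (0 : R) < 2 ^+ s by rewrite exprn_gt0.
have se : e^-1 < 2 ^+ s.
  rewrite (lt_le_trans (truncnS_gt _))// -natrX ler_nat.
  by rewrite ltn_expl.
have /andP[h1 h2] := h i; have := ceil_ge (2 ^+ s * z ord0 i).
have := floor_le (2 ^+ s * z ord0 i); move: h1 h2; rewrite ffunE/= => h1 h2 h3 h4.
have : `|2 ^+ s * (z ord0 i - y ord0 i)| <= 1.
  rewrite ler_norml mulrBr; apply/andP; split; lra.
rewrite normrM gtr0_norm// -ler_pdivlMl// mulr1 => h5.
by rewrite (le_lt_trans h5)// invf_plt// ?posrE.
Qed.

Lemma levelP O z : open O -> O z -> star_in O (level O z) z.
Proof.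
move=> oO Oz; rewrite /level; case: pselect => [e|[]].
  by case: ex_minnP => m /asboolP.
have /nbhs_ballP[e/= e0 be] : nbhs z O by exact: open_nbhs_nbhs.
have [s hs] := closed_star_small _ e0; exists s; apply/asboolP => y /hs zy.
by apply: be; split => // i j; rewrite (ord1 i) /ball/=; exact: zy.
Qed.

Section Open.
Variable O : set V.
Hypothesis oO : open O.

Lemma closed_cell_sub z : O z -> closed_cell (level O z) (cell_at O z) `<=` O.
Proof.
by move=> Oz; apply: subset_trans (levelP _ _ oO Oz); exact: closed_cell_sub_star.
Qed.

(** If [z] had a smaller level, its star at that scale would contain the star of [w], so that scale
    would serve [w] too, against minimality. *)
Lemma level_closed_cell w z : O w -> closed_cell (level O w) (cell_at O w) z ->
  (level O w <= level O z)%N.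
Proof.
move=> Ow h; rewrite leqNgt; apply/negP => lt.
have := levelP _ _ oO (closed_cell_sub _ Ow _ h).
have h' := closed_cell_coarser _ _ _ _ (ltnW lt) h.
move=> /(subset_trans (cell_star_anti _ _ _ h')) /level_le.
by rewrite leqNgt lt.
Qed.

(** This replaces the boundary condition of a cell complex. Levels on the closed cell are at least
    that of [w], so [closed_cell_dim] applies; in its second case [z] and [w] have the same star at
    the level of [w], hence the same level. *)
Lemma closed_cell_face w z : O w -> closed_cell (level O w) (cell_at O w) z ->
  (cell_dim (cell_at O z) < cell_dim (cell_at O w))%N \/
  (level O z = level O w /\ cell_at O z = cell_at O w).
Proof.
move=> Ow h; have le := level_closed_cell _ _ Ow h.
have [?|e] := closed_cell_dim _ _ _ _ le h; [by left|right].
suff el : level O z = level O w by split=> //; rewrite /cell_at el.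
apply/eqP; rewrite eqn_leq le andbT; apply: level_le.
by rewrite /star_in e; exact: levelP.
Qed.

(** At the level of [z], a nearby [w] has [z] in its closed cell, hence its star lies in that of
    [z], and this scale serves [w] as well. *)
Lemma near_cell z : O z -> \forall w \near z,
  [/\ O w, (level O w <= level O z)%N & closed_cell (level O w) (cell_at O w) z].
Proof.
move=> Oz; apply: filterS (near_closed_cell (level O z) z) => w hw.
have st : star_in O (level O z) w.
  by apply: subset_trans (levelP _ _ oO Oz); exact: cell_star_anti.
have le := level_le _ _ _ st; split=> //.
  by apply: st; exact: cell_star_code.
exact: closed_cell_coarser hw.
Qed.

End Open.

End DyadicCells.

(** * Filling cubes *)

Definition continuous_on {T U : topologicalType} (S : set T) (f : T -> U) :=
  forall p, S p -> forall W, nbhs (f p) W -> \forall q \near p, S q -> W (f q).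

Lemma row_continuous {T U : topologicalType} {k : nat} (f : 'I_k -> T -> U) :
  (forall i, continuous (f i)) -> continuous (fun t => \row_i f i t).
Proof.
move=> cf t W [P hP sP].
have h i : \forall u \near t, P ord0 i (f i u).
  by apply: cf; have := hP ord0 i; rewrite mxE.
apply: filterS (filter_forall _ h) => u hu.
by apply: sP => i j; rewrite mxE (ord1 i); exact: hu.
Qed.

Lemma continuous_pair_at {T U U' : topologicalType} (f : T -> U) (h : T -> U') t :
  {for t, continuous f} -> {for t, continuous h} ->
  {for t, continuous (fun t => (f t, h t))}.
Proof.
move=> cf ch W [[P Q] [/= hP hQ] sub].
have h1 : \forall u \near t, P (f u) := cf P hP.
have h2 : \forall u \near t, Q (h u) := ch Q hQ.
by apply: filterS2 h1 h2 => u Pu Qu; exact: sub.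
Qed.

Lemma continuous_pair {T U U' : topologicalType} (f : T -> U) (h : T -> U') :
  continuous f -> continuous h -> continuous (fun t => (f t, h t)).
Proof. by move=> cf ch t; apply: continuous_pair_at; [exact: cf|exact: ch]. Qed.

Lemma continuous_coord {T : topologicalType} {R : realType} {k : nat}
  (f : T -> 'rV[R]_k) i : continuous f -> continuous (fun t => f t ord0 i).
Proof.
move=> cf t; apply: (@continuous_comp _ _ _ f (fun v : 'rV_k => v ord0 i)).
  exact: cf.
exact: coord_continuous.
Qed.

Lemma continuous_affine {T : topologicalType} {R : realType} (f : T -> R) b c :
  continuous f -> continuous (fun t => b * f t + c).
Proof.
move=> cf t; apply: (@cvgD R R^o _ (nbhs t)); last exact: cvg_cst.
by apply: (@cvgM R _ (nbhs t)); [exact: cvg_cst|exact: cf].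
Qed.

Definition clamp01 {R : realType} (t : R) : R := Num.min 1 (Num.max 0 t).

Section Clamp.
Context {R : realType}.
Implicit Types t : R.

Lemma clamp01_itv t : 0 <= clamp01 t <= 1.
Proof. by rewrite /clamp01 le_min ler01 le_max lexx ge_min lexx. Qed.

Lemma clamp01_id t : 0 <= t <= 1 -> clamp01 t = t.
Proof.
move=> /andP[t0 t1]; rewrite /clamp01.
by rewrite (max_idPr _) ?(min_idPr _).
Qed.

Lemma clamp01_le0 t : t <= 0 -> clamp01 t = 0.
Proof. by move=> t0; rewrite /clamp01 (max_idPl _) // (min_idPr _). Qed.

Lemma clamp01_ge1 t : 1 <= t -> clamp01 t = 1.
Proof.
move=> t1; rewrite /clamp01 (min_idPl _)// (max_idPr _)//.
by rewrite (le_trans _ t1).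
Qed.

Lemma clamp01_continuous : continuous (@clamp01 R).
Proof.
move=> t; apply: continuous_min; first exact: cvg_cst.
by apply: continuous_max; [exact: cvg_cst|exact: cvg_id].
Qed.

End Clamp.

Definition cube_bd {R : realType} (d : nat) : set 'rV[R]_d.+1 :=
  [set v | (forall i, -1 <= v ord0 i <= 1) /\
           exists i, v ord0 i = 1 \/ v ord0 i = -1].

(** The form in which triviality of [[H_d, A]] is used: the boundary of the [(d+1)]-cube is a
    [d]-sphere, the face of coordinate 0 equal to [1] carries the base point, and a null sequence of
    such maps is one map on the shrinking wedge. As [psi] is continuous on the whole space, fillings
    of neighbouring cells can be compared without relative topologies. *)
Definition fillable (R : realType) {A : topologicalType} (a : A) (d : nat) :=
  forall phi : nat -> 'rV[R]_d.+1 -> A,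
    (forall k, continuous_on (cube_bd d) (phi k)) ->
    (forall k v, cube_bd d v -> v ord0 ord0 = 1 -> phi k v = a) ->
    (forall W, nbhs a W -> exists N, forall k v, (N <= k)%N ->
       cube_bd d v -> W (phi k v)) ->
  exists psi : nat -> 'rV[R]_d.+1 -> A,
    [/\ forall k, continuous (psi k),
        forall k v, cube_bd d v -> psi k v = phi k v &
        forall W, nbhs a W -> exists N, forall k v, (N <= k)%N -> W (psi k v)].

(** * Prisms over cells as cubes, and the enumeration of cells *)

Section CellCoordinates.
Context {R : realType} {n : nat}.
Local Notation V := 'rV[R]_n.
Implicit Types (s : nat) (c : {ffun 'I_n -> int * int}) (z w : V).

Definition dir_index d c (i : 'I_n) : 'I_d.+1 :=
  inord (index i (enum (cell_dirs c))).+1.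

(* The product of the closed cell of code [c] with the interval is identified
   with the cube [-1,1]^(d+1): coordinate 0 is the time, coordinate [k.+1] is
   the [k]-th nondegenerate direction of the cell. *)
Definition to_cube d s c (p : V * R) : 'rV[R]_d.+1 :=
  \row_k (if [pick i | (i \in cell_dirs c) && (dir_index d c i == k)] is Some i
          then 2 * (2 ^+ s * p.1 ord0 i - (c i).1%:~R) - 1
          else 2 * clamp01 p.2 - 1).

Definition of_cube d s c (v : 'rV[R]_d.+1) : V :=
  \row_i (if i \in cell_dirs c
          then ((c i).1%:~R + (v ord0 (dir_index d c i) + 1) / 2) / 2 ^+ s
          else (c i).1%:~R / 2 ^+ s).

Definition cube_time d (v : 'rV[R]_d.+1) : R := (v ord0 ord0 + 1) / 2.

(** Singles out the pairs that bound a grid point or an interval of one grid step, as codes of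
    points do. *)
Definition wf_code c := forall i, (c i).2 = (c i).1 + (i \in cell_dirs c)%:R.

Lemma wf_cell_code s z : wf_code (cell_code s z).
Proof. by move=> i; rewrite inE ffunE/= floor_eq_ceil ceil_floor natz. Qed.

Lemma to_cube_continuous d s c : continuous (to_cube d s c).
Proof.
apply: row_continuous => k; case: pickP => [i _|_].
  have -> : (fun p : V * R => 2 * (2 ^+ s * p.1 ord0 i - (c i).1%:~R) - 1) =
     (fun p => 2 * (2 ^+ s * p.1 ord0 i + (- (c i).1%:~R)) + (-1)) by [].
  do 2!apply: continuous_affine.
  by apply: continuous_coord => p; exact: cvg_fst.
apply: continuous_affine => p; apply: continuous_comp; first exact: cvg_snd.
exact: clamp01_continuous.
Qed.

Lemma of_cube_continuous d s c : continuous (of_cube d s c).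
Proof.
apply: row_continuous => i; case: (i \in _); last exact: cst_continuous.
have -> : (fun v : 'rV[R]_d.+1 => ((c i).1%:~R + (v ord0 (dir_index d c i) + 1) / 2)
   / 2 ^+ s) = (fun v => ((2 ^+ s)^-1 * 2^-1) * (v ord0 (dir_index d c i)) +
      ((2 ^+ s)^-1 * ((c i).1%:~R + 2^-1))).
  by apply/funext => v; rewrite mulrC; lra.
by apply: continuous_affine; exact: coord_continuous.
Qed.

Lemma cube_time_continuous d : continuous (@cube_time d).
Proof.
have -> : @cube_time d = (fun v => 2^-1 * (v ord0 ord0) + 2^-1).
  by apply/funext => v; rewrite /cube_time; lra.
by apply: continuous_affine; exact: coord_continuous.
Qed.

Section Dim.
Variables (d s : nat) (c : {ffun 'I_n -> int * int}).
Hypotheses (dimc : cell_dim c = d) (wfc : wf_code c).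

Lemma wf_codeR i : (c i).2%:~R = (c i).1%:~R + (i \in cell_dirs c)%:R :> R.
Proof. by rewrite {1}wfc intrD mulrz_nat. Qed.

Lemma dir_indexE i : i \in cell_dirs c ->
  dir_index d c i = (index i (enum (cell_dirs c))).+1 :> nat.
Proof.
move=> ic; rewrite inordK// ltnS -dimc /cell_dim cardE index_mem mem_enum.
exact: ic.
Qed.

Lemma dir_index_inj : {in cell_dirs c &, injective (dir_index d c)}.
Proof.
move=> i j ic jc /(congr1 (@nat_of_ord _)); rewrite !dir_indexE// => -[].
move=> e; rewrite -[i](@nth_index _ i i (enum (cell_dirs c))) ?mem_enum//.
by rewrite e nth_index ?mem_enum.
Qed.

Lemma dir_index_surj (k : 'I_d.+1) : k != ord0 ->
  exists2 i, i \in cell_dirs c & dir_index d c i = k.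
Proof.
case: k => -[//|k] kd _.
have kc : (k < size (enum (cell_dirs c)))%N by rewrite -cardE -/(cell_dim c) dimc.
have /hasP[i ic _] : has predT (enum (cell_dirs c)).
  by case: (enum _) kc.
have nc : nth i (enum (cell_dirs c)) k \in cell_dirs c by rewrite -mem_enum mem_nth.
exists (nth i (enum (cell_dirs c)) k) => //.
by apply/val_inj; rewrite /= dir_indexE// index_uniq// enum_uniq.
Qed.

Lemma to_cube_dir p i : i \in cell_dirs c ->
  to_cube d s c p ord0 (dir_index d c i) =
  2 * (2 ^+ s * p.1 ord0 i - (c i).1%:~R) - 1.
Proof.
move=> ic; rewrite mxE; case: pickP => [j /andP[jc /eqP/dir_index_inj ->]//|].
by move/(_ i); rewrite ic eqxx.
Qed.

Lemma to_cube_time p : to_cube d s c p ord0 ord0 = 2 * clamp01 p.2 - 1.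
Proof.
rewrite mxE; case: pickP => [j /andP[jc /eqP/(congr1 (@nat_of_ord _))]|//].
by rewrite dir_indexE.
Qed.

Lemma of_cubeK z t : closed_cell s c z -> of_cube d s c (to_cube d s c (z, t)) = z.
Proof.
have s0 : (2 ^+ s : R) != 0 by rewrite expf_neq0// pnatr_eq0.
move=> cz; apply/rowP => i; rewrite mxE; case: ifPn => ic.
  by rewrite to_cube_dir//=; field.
have := cz i; rewrite wf_codeR (negbTE ic) addr0 => h.
have -> : (c i).1%:~R = 2 ^+ s * z ord0 i by apply/eqP; rewrite eq_le.
by field.
Qed.

Lemma cube_timeK z t : cube_time d (to_cube d s c (z, t)) = clamp01 t.
Proof. by rewrite /cube_time to_cube_time /=; field. Qed.

Lemma to_cube_in z t : closed_cell s c z ->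
  forall k, -1 <= to_cube d s c (z, t) ord0 k <= 1.
Proof.
move=> cz k; have [->|/dir_index_surj[i ic <-]] := eqVneq k ord0.
  by rewrite to_cube_time/=; have := clamp01_itv t; lra.
rewrite to_cube_dir//=.
by have := cz i; rewrite wf_codeR ic /= mulr1n; lra.
Qed.

Lemma of_cube_in (v : 'rV[R]_d.+1) :
  (forall k, -1 <= v ord0 k <= 1) -> closed_cell s c (of_cube d s c v).
Proof.
have s0 : (2 ^+ s : R) != 0 by rewrite expf_neq0// pnatr_eq0.
move=> hv i; rewrite mxE wf_codeR; case: ifPn => ic.
  by rewrite mulrC divfK//= mulr1n; have := hv (dir_index d c i); lra.
by rewrite mulrC divfK// addr0 lexx.
Qed.

(** A direction of [c] whose cube coordinate is [1] or [-1] lands on the grid, so it is no longer a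
    direction of the code. *)
Lemma of_cube_side (v : 'rV[R]_d.+1) (k : 'I_d.+1) : (forall k, -1 <= v ord0 k <= 1) -> k != ord0 ->
  v ord0 k = 1 \/ v ord0 k = -1 -> cell_code s (of_cube d s c v) <> c.
Proof.
have s0 : (2 ^+ s : R) != 0 by rewrite expf_neq0// pnatr_eq0.
move=> hv /dir_index_surj[i ic <-] hk ec; move: (ic).
rewrite -ec inE ffunE/= floor_eq_ceil => /negP; apply.
rewrite mxE ic mulrC divfK//; apply: rpredD; first exact: intr_int.
case: hk => ->; last by rewrite addNr mul0r; exact: rpred0.
by have -> : (1 + 1) / 2 = 1 :> R; [field|exact: rpred1].
Qed.

Lemma to_cube_side z t : closed_cell s c z -> cell_code s z <> c ->
  cube_bd d (to_cube d s c (z, t)).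
Proof.
move=> cz ne; split; first exact: to_cube_in.
have [i ne_i] : exists i, cell_code s z i <> c i.
  by apply/existsNP => e; apply: ne; apply/ffunP.
have := cz i; rewrite wf_codeR; have [ic|ic] := boolP (i \in cell_dirs c); last first.
  rewrite addr0 => h; case: ne_i; rewrite ffunE.
  have -> : 2 ^+ s * z ord0 i = (c i).1%:~R by apply/eqP; rewrite eq_le andbC.
  rewrite intrKfloor intrKceil; move: (wfc i); rewrite (negbTE ic) addr0.
  by case: (c i) => ? ? /= ->.
rewrite /= => /andP[h1 h2].
exists (dir_index d c i); rewrite to_cube_dir//=.
have [h|h] := eqVneq (2 ^+ s * z ord0 i) (c i).1%:~R; first by right; lra.
have [h'|h'] := eqVneq (2 ^+ s * z ord0 i) ((c i).1%:~R + 1); first by left; lra.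
case: ne_i; rewrite ffunE; set x := 2 ^+ s * z ord0 i in h1 h2 h h' *.
have fx : Num.floor x = (c i).1.
  by apply: floor_def; rewrite h1 intrD lt_neqAle h' h2.
have cx : Num.ceil x = (c i).1 + 1.
  by apply: ceil_def; rewrite addrK intrD h2 andbT lt_neqAle eq_sym h h1.
move: (wfc i); rewrite ic fx cx; by case: (c i) => ? ? /= ->.
Qed.

Lemma to_cube_end z t : closed_cell s c z -> t <= 0 \/ 1 <= t ->
  cube_bd d (to_cube d s c (z, t)).
Proof.
move=> cz ht; split; first exact: to_cube_in.
exists ord0; rewrite to_cube_time/=.
by case: ht => [/clamp01_le0|/clamp01_ge1] ->; [right|left]; lra.
Qed.

End Dim.

Lemma closed_cell_closed s c : closed (closed_cell s c : set V).
Proof.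
have -> : closed_cell s c =
  \bigcap_(i in [set: 'I_n]) ((fun z : V => 2 ^+ s * z ord0 i) @^-1`
     `[(c i).1%:~R, (c i).2%:~R]).
  apply/seteqP; split => z h i; first by move=> _; rewrite /= in_itv; exact: h.
  by have := h i I; rewrite /= in_itv.
apply: closed_bigI => i _; apply: closed_comp; last exact: itv_closed.
move=> z _; have -> : (fun z : V => 2 ^+ s * z ord0 i) = fun z => 2 ^+ s * z ord0 i + 0.
  by apply/funext => ?; rewrite addr0.
by apply: continuous_affine; exact: coord_continuous.
Qed.

(** Map index, scale and code. [pickle] numbers these triples and so turns the cells of all maps
    into one sequence; most triples are not cells of the given maps. *)
Definition cell_index := (nat * (nat * {ffun 'I_n -> int * int}))%type.

Lemma pickle_bounded (N B : nat) : exists K, forall (m s : nat) c,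
  (m < N)%N -> (s < N)%N -> (forall i, `|(c i).1| <= B%:Z /\ `|(c i).2| <= B%:Z) ->
  (pickle ((m, (s, c)) : cell_index) < K)%N.
Proof.
(* The ordinal [x + B] stands for the integer [x] with [|x| <= B], so the triples in question come
   from a finite type. *)
pose D (f : 'I_N * ('I_N * {ffun 'I_n -> 'I_(B + B).+1 * 'I_(B + B).+1})) : cell_index :=
  (nat_of_ord f.1, (nat_of_ord f.2.1,
    [ffun i => ((f.2.2 i).1%:Z - B%:Z, (f.2.2 i).2%:Z - B%:Z)])).
exists (\max_f (pickle (D f))).+1 => m s c mN sN cB.
pose e (x : int) : 'I_(B + B).+1 := inord (absz (x + B%:Z)).
have eK x : `|x| <= B%:Z -> (e x)%:Z - B%:Z = x.
  by move=> xB; rewrite /e inordK; lia.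
have -> : (m, (s, c)) = D (Ordinal mN, (Ordinal sN, [ffun i => (e (c i).1, e (c i).2)])).
  congr (_, (_, _)); apply/ffunP => i; rewrite !ffunE /=.
  by have [h1 h2] := cB i; rewrite !eK//; case: (c i).
by rewrite ltnS; exact: leq_bigmax.
Qed.

Lemma cell_code_bounded (N B : nat) : exists B' : nat, forall s z, (s < N)%N ->
  (forall i, `|z ord0 i| <= B%:R) ->
  forall i, `|(cell_code s z i).1| <= B'%:Z /\ `|(cell_code s z i).2| <= B'%:Z.
Proof.
exists (2 ^ N * B).+1 => s z sN zB i.
have h : `|2 ^+ s * z ord0 i| <= ((2 ^ N * B)%N%:R : R).
  rewrite normrM natrM ler_pM//.
  by rewrite ger0_norm ?exprn_ge0// -natrX ler_nat leq_exp2l// ltnW.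
move: h; rewrite ler_norml => /andP[h1 h2]; rewrite ffunE/=; move: h1 h2.
set x := 2 ^+ s * z ord0 i; set K := (2 ^ N * B)%N => h1 h2.
have f1 : - K%:Z <= Num.floor x by rewrite floor_ge_int intrN.
have f2 : Num.ceil x <= K%:Z by rewrite ceil_le_int.
have : Num.floor x <= Num.ceil x by rewrite -(ler_int R) (le_trans (floor_le x))// ceil_ge.
have : Num.ceil x <= Num.floor x + 1 by rewrite ceil_floor lerD2l; case: (_ \is a _).
by move: f1 f2; move: (Num.floor x) (Num.ceil x) => f e; lia.
Qed.

Lemma cell_index_bounded (N B : nat) : exists K, forall (m s : nat) z,
  (m < N)%N -> (s < N)%N -> (forall i, `|z ord0 i| <= B%:R) ->
  (pickle ((m, (s, cell_code s z)) : cell_index) < K)%N.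
Proof.
have [B' hB'] := cell_code_bounded N B; have [K hK] := pickle_bounded N B'.
by exists K => m s z mN sN zB; apply: hK => //; exact: hB'.
Qed.

(** Local finiteness of the cells, put as a bound on their numbers, so that neighbourhoods can be
    intersected over ['I_K]. *)
Lemma near_cell_index_bounded (m N : nat) z : exists K, \forall w \near z,
  forall s, (s < N)%N -> (pickle ((m, (s, cell_code s w)) : cell_index) < K)%N.
Proof.
pose B := \max_i (Num.truncn (`|z ord0 i| + 1)).+1.
have [K hK] := cell_index_bounded (maxn m.+1 N) B; exists K.
have nz i : \forall w \near z, `|(w : V) ord0 i| <= B%:R.
  have : \forall x \near z ord0 i, `|x| < B%:R.
    apply/nbhs_ballP; exists 1 => //= x; rewrite /ball/= => zx.
    rewrite -(subKr (z ord0 i) x) (le_lt_trans (ler_normB _ _))//.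
    apply: (@lt_le_trans _ _ ((Num.truncn (`|z ord0 i| + 1)).+1%:R)).
      by rewrite (lt_trans _ (truncnS_gt _))// ltrD2l.
    by rewrite ler_nat (leq_bigmax i).
  move=> h; have c : (fun w : V => w ord0 i) @ z --> z ord0 i by exact: coord_continuous.
  apply: (@filterS _ _ _ (fun w : V => `|w ord0 i| < B%:R)) => [w /ltW//|].
  exact: (c _ h).
apply: filterS (filter_forall _ nz) => w wB s sN; apply: hK => //.
  by rewrite leq_max ltnSn.
by rewrite leq_max sN orbT.
Qed.

End CellCoordinates.

(** * Contracting null sequences of maps relative to a point preimage *)

Section Contraction.
Context {R : realType} {n : nat} {A : topologicalType} (a : A).
Local Notation V := 'rV[R]_n.
Implicit Types (z w : V) (t : R) (m N : nat).

(** Neighbourhoods of infinity, measured by the largest coordinate; in dimension 0 no point is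
    far. *)
Definition far N z := exists i, N%:R <= `|z ord0 i|.

Lemma farW N N' z : (N' <= N)%N -> far N z -> far N' z.
Proof. by move=> NN' [i hi]; exists i; rewrite (le_trans _ hi)// ler_nat. Qed.

(** Cells have side [2 ^- s <= 1], so moving within one costs at most one unit. *)
Lemma far_closed_cell s z w N :
  closed_cell s (cell_code s w) z -> far N.+1 w -> far N z.
Proof.
have s1 : 1 <= 2 ^+ s :> R by rewrite exprn_ege1// ler1n.
have s0 : 0 < 2 ^+ s :> R by rewrite exprn_gt0.
move=> h [i hi]; exists i.
have /andP[] := closed_cell_sub_star _ _ _ h i.
have := ceil_ge (2 ^+ s * w ord0 i); have := floor_le (2 ^+ s * w ord0 i).
rewrite ffunE/= => h1 h2 h3 h4.
have : `|2 ^+ s * (w ord0 i - z ord0 i)| <= 1.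
  by rewrite ler_norml mulrBr; apply/andP; split; lra.
rewrite normrM gtr0_norm// => h5.
have h6 : `|w ord0 i - z ord0 i| <= 1.
  by rewrite (le_trans _ h5)// ler_peMl.
have := ler_normD (w ord0 i - z ord0 i) (z ord0 i).
by rewrite subrK; move: hi; rewrite -[N.+1]addn1 natrD; lra.
Qed.

Lemma norm_le_cell_code s z i :
  `|z ord0 i| <= (absz (cell_code s z i).1 + absz (cell_code s z i).2)%:R.
Proof.
have s1 : 1 <= 2 ^+ s :> R by rewrite exprn_ege1// ler1n.
have /andP[] := closed_cell_code s z i.
move: (cell_code s z i) => [p q] /= h1 h2.
apply: (@le_trans _ _ `|2 ^+ s * z ord0 i|).
  by rewrite normrM ler_peMl// ger0_norm// (le_trans _ s1).
rewrite natrD !natr_absz !intr_norm.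
move: h1 h2; move: (2 ^+ s * z ord0 i) (p%:~R : R) (q%:~R : R) => x p' q' h1 h2.
have := ler_norm q'; have := ler_norm (- p'); rewrite normrN.
have := normr_ge0 p'; have := normr_ge0 q'.
by rewrite ler_norml; move: `|p'| `|q'| => ? ? *; apply/andP; split; lra.
Qed.

Section Family.
Variable g : nat -> V -> A.
Hypothesis (a_closed : closed [set a]).
Hypothesis (g_continuous : forall m, continuous (g m)).
Hypothesis (g_null : forall W, nbhs a W -> exists N, forall m z, (N <= m)%N -> W (g m z)).
Hypothesis (g_infty : forall m W, nbhs a W -> exists N, forall z, far N z -> W (g m z)).

Definition moved m : set V := [set z | g m z <> a].

Lemma moved_open m : open (moved m).
Proof.
have -> : moved m = g m @^-1` (~` [set a]) by [].
by apply: open_comp => [z _|]; [exact: g_continuous|exact: closed_openC].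
Qed.

Local Notation lev m := (level (moved m)).
Local Notation cell m := (cell_at (moved m)).

(* [deep N m z]: either the map has large index, or [z] lies in a small cell, or
   it is far from the origin; along such points the maps must be close to [a]. *)
Definition deep N m z := [\/ (N <= m)%N, (N <= lev m z)%N | far N z].

Lemma deepW N N' m z : (N' <= N)%N -> deep N m z -> deep N' m z.
Proof.
move=> NN' [h|h|h]; [apply: Or31|apply: Or32|apply: Or33].
- exact: leq_trans h.
- exact: leq_trans h.
- exact: farW h.
Qed.

Lemma deep_closed_cell N m z w : moved m w ->
  closed_cell (lev m w) (cell m w) z -> deep N.+1 m w -> deep N m z.
Proof.
move=> mw cz [h|h|h]; [apply: Or31|apply: Or32|apply: Or33].
- exact: ltnW.
- have := level_closed_cell _ (moved_open m) _ _ mw cz.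
  by apply: leq_trans; exact: ltnW.
- exact: (far_closed_cell (lev m w) z w N cz h).
Qed.

(** By [near_cell] the level is locally bounded; compactness makes the bound global. *)
Lemma level_bounded m (K : set V) : compact K -> K `<=` moved m ->
  exists N, forall z, K z -> (lev m z <= N)%N.
Proof.
move=> /compact_near_coveringP cK KO.
have := cK nat \oo (fun N z => (lev m z <= N)%N) _.
case=> [z Kz|N _ hN]; last by exists N => z; apply: hN => /=.
have := near_cell _ (moved_open m) z (KO _ Kz) => nz.
exists ([set w | (lev m w <= lev m z)%N], [set N | (lev m z <= N)%N]).
  split; last exact: nbhs_infty_ge.
  by apply: filterS nz => w [].
by move=> [w N] /= [h1 h2]; exact: leq_trans h1 h2.
Qed.

(** Large [m] is [g_null]. For each of the remaining finitely many [m], the points not sent into the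
    interior of [W] form a closed set, bounded by [g_infty] and contained in [moved m] since [a] is
    interior to [W]; on this compact set the level is bounded. *)
Lemma g_deep W : nbhs a W -> exists N, forall m z, moved m z -> deep N m z -> W (g m z).
Proof.
move=> aW; have [N0 hN0] := g_null _ aW.
have hm m : exists N, forall z, moved m z -> (N <= lev m z)%N \/ far N z -> W (g m z).
  have [N1 hN1] := g_infty m _ (nbhs_interior aW).
  pose K := [set z | ~ (W°) (g m z)].
  have Kbox : K `<=` [set z : V | forall i, `[- N1%:R, N1%:R]%classic (z ord0 i)].
    move=> z Kz i; rewrite /= in_itv/= -ler_norml leNgt; apply/negP => hz.
    by apply: Kz; apply: hN1; exists i; exact: ltW.
  have cK : compact K.
    apply: subclosed_compact Kbox.
      rewrite (_ : K = g m @^-1` (~` W°)) //; apply: closed_comp.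
        by move=> z _; exact: g_continuous.
      exact/open_closedC/open_interior.
    apply: (@rV_compact R n (fun=> `[- N1%:R, N1%:R]%classic)) => i.
    exact: segment_compact.
  have KO : K `<=` moved m by move=> z + ga; apply; rewrite ga; exact: nbhs_singleton (nbhs_interior aW).
  have [N2 hN2] := level_bounded _ _ cK KO.
  exists (maxn N1 N2.+1) => z mz [h|h]; last first.
    by apply: interior_subset; apply: hN1; apply: farW h; rewrite leq_maxl.
  apply: contrapT => nW; have /hN2 : K z by move=> /interior_subset.
  by rewrite leqNgt (leq_trans _ h)// leq_maxr.
have [f hf] := choice hm.
exists (maxn N0 (\max_(m < N0) f m)) => m z mz dz.
have [h|h] := leqP N0 m; first exact: hN0.
have le : (f m <= maxn N0 (\max_(m < N0) f m))%N.
  by rewrite leq_max (leq_bigmax (Ordinal h)) orbT.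
apply: (hf m) => //; case: dz => dz.
- by move: dz; rewrite geq_max leqNgt h.
- by left; exact: leq_trans dz.
- by right; exact: farW dz.
Qed.

(** The strict inequality makes [skel 0] empty, so the induction starts from nothing. *)
Definition skel d m : set V := [set z | moved m z /\ (cell_dim (cell m z) < d)%N].

(** The values at both ends are imposed even off the skeleton, so that the next step finds the
    bottom and top of its prisms prescribed. The last clause is convergence to [a], uniform over all
    maps at once. *)
Definition skel_contraction d (G : nat -> V * R -> A) :=
  [/\ forall m z t, t <= 0 -> G m (z, t) = g m z,
      forall m z t, 1 <= t -> G m (z, t) = a,
      forall m, continuous_on (skel d m `*` setT) (G m) &
      forall W, nbhs a W -> exists N, forall m z t, skel d m z -> deep N m z -> W (G m (z, t))].

(** * Extending the contraction over the cells of dimension [d] *)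

Section Step.
Variables (d : nat) (G : nat -> V * R -> A).
Hypotheses (fill_d : fillable R a d) (GP : skel_contraction d G).

Let G0 m z t : t <= 0 -> G m (z, t) = g m z. Proof. by case: GP => h _ _ _; exact: h. Qed.
Let G1 m z t : 1 <= t -> G m (z, t) = a. Proof. by case: GP => _ h _ _; exact: h. Qed.

Let active m s c := exists z, [/\ moved m z, lev m z = s, cell m z = c & cell_dim c = d].

(** The boundary data of the prism with number [k]. Numbers that belong to no [d]-dimensional cell
    receive the constant map [a], which keeps the sequence null. *)
Let phi k (v : 'rV[R]_d.+1) : A :=
  if (pickle_inv k : option (@cell_index n)) is Some (m, (s, c)) then
    if `[< active m s c >] then G m (of_cube d s c v, cube_time d v) else a
  else a.

Let bd_cases m s c : active m s c -> forall v : 'rV[R]_d.+1, cube_bd d v ->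
  forall i : 'I_d.+1, v ord0 i = 1 \/ v ord0 i = -1 -> i != ord0 ->
  skel d m (of_cube d s c v).
Proof.
move=> [z [mz ls cs dc]] v [v1 _] i vi i0.
have wfc : wf_code c by rewrite -cs; exact: wf_cell_code.
have cc : closed_cell (lev m z) (cell m z) (of_cube d s c v).
  by rewrite ls cs; exact: of_cube_in.
split; first exact: (closed_cell_sub _ (moved_open m) _ mz _ cc).
have [|[el ec]] := closed_cell_face _ (moved_open m) _ _ mz cc; first by rewrite cs dc.
exfalso; apply: (of_cube_side _ _ _ dc v i v1 i0 vi).
by rewrite -[RHS]cs -ec /cell_at el ls.
Qed.

Let phi_continuous k : continuous_on (cube_bd d) (phi k).
Proof.
rewrite /phi; case: (pickle_inv k) => [[m [s c]]|]; last first.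
  by move=> v _ W aW; near=> q; move=> _; exact: nbhs_singleton.
case: asboolP => [act|_]; last by move=> v _ W aW; near=> q; move=> _; exact: nbhs_singleton.
move=> v bv W.
(* Near [v], a boundary point lies only on faces that also pass through [v]; continuity is therefore
   checked on bottom, top and sides separately. *)
have nq : \forall q \near v, forall i, ((q : 'rV[R]_d.+1) ord0 i = 1 -> v ord0 i = 1) /\
    (q ord0 i = -1 -> v ord0 i = -1).
  suff h (x : R) i : \forall q \near v, (q : 'rV[R]_d.+1) ord0 i = x -> v ord0 i = x.
    exact: (filter_forall _ (fun i => filterI (h 1 i) (h (-1) i))).
  have [->|ne] := eqVneq (v ord0 i) x; first by near=> q.
  have : \forall y \near v ord0 i, y != x.
    by apply: open_nbhs_nbhs; split => //; exact: open_neq.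
  move=> h; apply: (@filterS _ _ _ (fun q : 'rV[R]_d.+1 => q ord0 i != x)).
    by move=> q /eqP qx /qx.
  exact: (@coord_continuous R 1 d.+1 ord0 i v _ h).
pose F (q : 'rV[R]_d.+1) : V * R := (of_cube d s c q, cube_time d q).
have cF : continuous F.
  by apply: continuous_pair; [exact: of_cube_continuous|exact: cube_time_continuous].
move=> Wv.
have n0 : v ord0 ord0 = -1 -> \forall q \near v, W (g m (of_cube d s c q)).
  move=> v0; apply: (@continuous_comp _ _ _ (of_cube d s c) (g m) v).
  - exact: of_cube_continuous.
  - exact: g_continuous.
  - by move: Wv; rewrite G0//= /cube_time v0; lra.
have n1 : v ord0 ord0 = 1 -> W a.
  by move=> v0; move: Wv; rewrite G1 /cube_time ?v0 => [/nbhs_singleton//|]; lra.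
have n2 : skel d m (of_cube d s c v) -> \forall q \near v, skel d m (of_cube d s c q) -> W (G m (F q)).
  move=> sv; case: GP => _ _ /(_ m (F v) (conj sv I) W Wv) h _.
  have h' : \forall q \near v, (skel d m `*` setT) (F q) -> W (G m (F q)) := cF _ _ h.
  by apply: filterS h' => q hq sq; apply: hq.
have n0' : \forall q \near v, v ord0 ord0 = -1 -> W (g m (of_cube d s c q)).
  by case: (pselect (v ord0 ord0 = -1)) => [/n0 h|h]; [apply: filterS h|near=> q].
have n2' : \forall q \near v, skel d m (of_cube d s c v) -> skel d m (of_cube d s c q) -> W (G m (F q)).
  case: (pselect (skel d m (of_cube d s c v))) => [/n2 h|h]; last by near=> q.
  by apply: filterS h => q hq _.
near=> q; move=> bq.
have hq : forall i, (q ord0 i = 1 -> v ord0 i = 1) /\ (q ord0 i = -1 -> v ord0 i = -1) by near: q.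
have [i hi] := bq.2.
have hv : v ord0 i = 1 \/ v ord0 i = -1.
  by case: hi => hi; [left; apply (hq i).1|right; apply (hq i).2].
have [i0|i0] := eqVneq i ord0; last first.
  by apply: (near n2' q) => //; apply: bd_cases i0.
rewrite i0 in hi; case: hi => hi.
  by rewrite G1 /cube_time ?hi; [apply: n1; apply (hq ord0).1|lra].
rewrite G0 /cube_time ?hi; last by lra.
by apply: (near n0' q) => //; apply (hq ord0).2.
Unshelve. all: by end_near. Qed.

Let phi_top k v : cube_bd d v -> v ord0 ord0 = 1 -> phi k v = a.
Proof.
move=> _ v1; rewrite /phi; case: (pickle_inv k) => [[m [s c]]|//].
by case: asboolP => // _; rewrite G1// /cube_time v1; lra.
Qed.

Let phi_null W : nbhs a W -> exists N, forall k v, (N <= k)%N -> cube_bd d v -> W (phi k v).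
Proof.
move=> aW; have [N1 hN1] := g_deep _ aW.
case: GP => _ _ _ /(_ _ aW) [N2 hN2].
pose N := maxn N1 N2.
have [K hK] := @cell_index_bounded R n N.+1 N.+1.
exists K => k v Kk bv; rewrite /phi; case e: (pickle_inv k) => [[m [s c]]|]; last first.
  exact: nbhs_singleton.
case: asboolP => [act|_]; last exact: nbhs_singleton.
have [z [mz ls cs dc]] := act.
(* Triples whose map index, scale and coordinates are all small have numbers below [K], so here one
   of them is large. The extra [1] is spent on passing from [z] to the rest of its closed cell. *)
have dz : deep N.+1 m z.
  apply: contrapT => nd; move: Kk; rewrite leqNgt => /negP; apply.
  have := @pickle_invK (@cell_index n) k; rewrite e /= => <-.
  rewrite -cs -ls; apply: hK.
  - by rewrite ltnNge; apply/negP => h; apply: nd; exact: Or31.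
  - by rewrite ltnNge; apply/negP => h; apply: nd; exact: Or32.
  - move=> i; rewrite leNgt; apply/negP => h; apply: nd; apply: Or33.
    by exists i; exact: ltW.
have wfc : wf_code c by rewrite -cs; exact: wf_cell_code.
have cc : closed_cell (lev m z) (cell m z) (of_cube d s c v).
  by rewrite ls cs; apply: of_cube_in bv.1.
have mv : moved m (of_cube d s c v) by exact: (closed_cell_sub _ (moved_open m) _ mz _ cc).
have dv := deep_closed_cell _ _ _ _ mz cc dz.
have [i hi] := bv.2; have [i0|i0] := eqVneq i ord0; last first.
  apply: hN2; first exact: bd_cases i0.
  by apply: deepW dv; rewrite leq_maxr.
rewrite i0 in hi; case: hi => hi.
  by rewrite G1 /cube_time ?hi; [exact: nbhs_singleton|lra].
rewrite G0 /cube_time ?hi; last by lra.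
by apply: hN1 => //; apply: deepW dv; rewrite leq_maxl.
Qed.

(** Each open [d]-cell takes the filling of its own prism, and lower cells keep [G]. Continuity
    rests on two facts: a filling agrees with the new homotopy on its whole closed cell, and only
    finitely many fillings occur near a point. *)
Lemma skel_contraction_step : exists G', skel_contraction d.+1 G'.
Proof.
have [psi [psi_continuous psi_bd psi_null]] := fill_d _ phi_continuous phi_top phi_null.
pose idx m z : @cell_index n := (m, (lev m z, cell m z)).
pose tc m w p := psi (pickle (idx m w)) (to_cube d (lev m w) (cell m w) p).
pose G' m (p : V * R) := if `[< moved m p.1 /\ cell_dim (cell m p.1) = d >]
                         then tc m p.1 p else G m p.
have wfc m w : wf_code (cell m w) by exact: wf_cell_code.
have tc_bd m w z t : moved m w -> cell_dim (cell m w) = d ->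
    closed_cell (lev m w) (cell m w) z ->
    cube_bd d (to_cube d (lev m w) (cell m w) (z, t)) -> tc m w (z, t) = G m (z, t).
  move=> mw dw cz bd; rewrite /tc psi_bd// /phi pickleK_inv /idx.
  case: asboolP => [_|[]]; last by exists w.
  rewrite of_cubeK// cube_timeK//.
  have [t0|t0] := leP t 0; first by rewrite clamp01_le0// !G0.
  have [t1|t1] := leP 1 t; first by rewrite clamp01_ge1// !G1.
  by rewrite clamp01_id// !ltW.
(* By [closed_cell_face], [z] has either the cell of [w], hence the same filling, or a cell of lower
   dimension; in the latter case it sits on a side of the prism, where the filling restricts to
   [G]. *)
have tcE m w z t : moved m w -> cell_dim (cell m w) = d ->
    closed_cell (lev m w) (cell m w) z -> tc m w (z, t) = G' m (z, t).
  move=> mw dw cz; rewrite /G' /=.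
  have [lt|[el ec]] := closed_cell_face _ (moved_open m) _ _ mw cz; last first.
    case: asboolP => [_|[]]; first by rewrite /tc /idx el ec.
    by split; [exact: (closed_cell_sub _ (moved_open m) _ mw)|rewrite ec].
  case: asboolP => [[_ dz]|_]; first by move: lt; rewrite dz dw ltnn.
  apply: tc_bd => //; apply: to_cube_side => //.
  move=> e; have le := level_closed_cell _ (moved_open m) _ _ mw cz.
  have el : lev m z = lev m w.
    apply/eqP; rewrite eqn_leq le andbT; apply: level_le.
    by rewrite /star_in e; exact: (levelP _ _ (moved_open m) mw).
  by move: lt; rewrite /cell_at el -/(cell m w) e ltnn.
have ends m z t : t <= 0 \/ 1 <= t -> G' m (z, t) = G m (z, t).
  move=> ht; rewrite /G' /=; case: asboolP => // -[mz dz].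
  have cz : closed_cell (lev m z) (cell m z) z by exact: closed_cell_code.
  by apply: tc_bd => //; apply: to_cube_end.
exists G'; split.
- by move=> m z t t0; rewrite ends ?G0//; left.
- by move=> m z t t1; rewrite ends ?G1//; right.
- move=> m [z t] [[/= mz dz] _] W Wz.
  have nz := near_cell _ (moved_open m) z mz.
  have [K hK] := near_cell_index_bounded m (lev m z).+1 z.
  (* All candidate fillings with number below [K]. Those used near [z] have [z] in their closed
     cell, so by [tcE] they take the value of [G'] at [(z, t)]; the premise in [nH] filters out the
     others. *)
  pose H k (p : V * R) : A :=
    if (pickle_inv k : option (@cell_index n)) is Some (m, (s, c))
    then psi k (to_cube d s c p) else a.
  have cH k : continuous (H k).
    rewrite /H; case: (pickle_inv k) => [[m' [s c]]|]; last exact: cst_continuous.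
    move=> p; apply: (@continuous_comp _ _ _ (to_cube d s c) (psi k)).
      exact: to_cube_continuous.
    exact: psi_continuous.
  have nH : \forall p \near (z, t), forall k : 'I_K, nbhs (H k (z, t)) W -> W (H k p).
    suff h (k : 'I_K) : \forall p \near (z, t), nbhs (H k (z, t)) W -> W (H k p).
      exact: (filter_forall _ h).
    case: (pselect (nbhs (H k (z, t)) W)) => h; last by near=> p.
    have h' : \forall p \near (z, t), W (H k p) := cH k (z, t) W h.
    by apply: filterS h' => p.
  (* If a nearby [p] lies over the lower skeleton, so does [z], which belongs to the closed cell of
     [p.1]; then the continuity of [G] at [(z, t)] applies. *)
  have nG : \forall p \near (z, t), skel d m z -> skel d m p.1 -> W (G m p).
    case: (pselect (skel d m z)) => [sz|h]; last by near=> p.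
    have Wz' : nbhs (G m (z, t)) W.
      move: Wz; rewrite /G'/=; case: asboolP => // -[_ dz'].
      by case: sz => _; rewrite dz' ltnn.
    case: GP => _ _ /(_ m (z, t) (conj sz I) W Wz') h _.
    by apply: filterS h => p hp _ sp; apply: hp.
  have n1 : \forall p \near (z, t), [/\ moved m p.1, (lev m p.1 <= lev m z)%N &
      closed_cell (lev m p.1) (cell m p.1) z] by exact: (cvg_fst nz).
  have n2 : \forall p \near (z, t), forall s, (s < (lev m z).+1)%N ->
    (pickle ((m, (s, cell_code s p.1)) : cell_index) < K)%N by exact: (cvg_fst hK).
  near=> p; move=> [[mp dp] _].
  have [_ lp cp] : [/\ moved m p.1, (lev m p.1 <= lev m z)%N &
      closed_cell (lev m p.1) (cell m p.1) z] by near: p.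
  have hp : (pickle (idx m p.1) < K)%N by apply: (near n2 p).
  rewrite {1}/G'; case: asboolP => [[_ dp']|ndp].
    have -> : tc m p.1 p = H (Ordinal hp) p by rewrite /H /= pickleK_inv.
    apply: (near nH p) => //.
    have -> : H (Ordinal hp) (z, t) = tc m p.1 (z, t) by rewrite /H /= pickleK_inv.
    by rewrite tcE.
  have dpd : (cell_dim (cell m p.1) < d)%N.
    rewrite ltn_neqAle -ltnS dp andbT; apply/eqP => e; exact: ndp.
  apply: (near nG p) => //; split => //.
  have [lt|[_ ->]//] := closed_cell_face _ (moved_open m) _ _ mp cp.
  exact: ltn_trans lt dpd.
- move=> W aW; have [K hK] := psi_null _ aW.
  case: GP => _ _ _ /(_ _ aW) [N hN].
  (* [ht k] exceeds the map index, the scale and all coordinates of points in the cell with number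
     [k], so no point deep to depth [ht k] lies in it. This excludes the finitely many numbers below
     [K]. *)
  pose ht k := if (pickle_inv k : option (@cell_index n)) is Some (m, (s, c))
    then (m + s + \sum_i (absz (c i).1 + absz (c i).2))%N.+1 else 0%N.
  exists (maxn N (\max_(k < K) ht k)) => m z t [mz dz] dpz; rewrite /G'/=.
  case: asboolP => [[_ dz']|ndz]; last first.
    apply: hN; last by apply: deepW dpz; rewrite leq_maxl.
    by split=> //; rewrite ltn_neqAle -ltnS dz andbT; apply/eqP => e; exact: ndz.
  have [Kk|Kk] := leqP K (pickle (idx m z)); first exact: hK.
  exfalso.
  have htz : (ht (pickle (idx m z)) <= maxn N (\max_(k < K) ht k))%N.
    by rewrite leq_max (leq_bigmax (Ordinal Kk)) orbT.
  have {dpz} := deepW _ _ _ _ htz dpz; rewrite /ht pickleK_inv /idx => -[h|h|[i hi]].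
  - by move: h; rewrite -addnA ltnNge leq_addr.
  - by move: h; rewrite addnAC ltnNge leq_addl.
  - have := le_trans hi (norm_le_cell_code (lev m z) z i); rewrite ler_nat.
    by rewrite (bigD1 i)//= addnCA ltnNge leq_addr.
Unshelve. all: by end_near. Qed.

End Step.

(** Cells have dimension at most [n], so the skeleton [n.+1] is all of [moved m]; elsewhere the
    homotopy stays at [a]. It is continuous at an unmoved point because moved points close to it
    have large level. *)
Theorem contract_rel : (forall d, (d <= n)%N -> fillable R a d) ->
  exists G : nat -> V * R -> A,
  [/\ forall m, continuous (G m),
      forall m z t, t <= 0 -> G m (z, t) = g m z,
      forall m z t, 1 <= t -> G m (z, t) = a,
      forall m z t, g m z = a -> G m (z, t) = a &
      (forall W, nbhs a W -> exists N, forall m p, (N <= m)%N -> W (G m p)) /\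
      (forall m W, nbhs a W -> exists N, forall z t, far N z -> W (G m (z, t)))].
Proof.
move=> fill.
have [G [G0 G1 Gc Gd]] : exists G, skel_contraction n.+1 G.
  have : (n.+1 <= n.+1)%N by []; elim: {1 3}n.+1 => [_|d IH dn].
    (* Over the empty skeleton continuity is void, so a jump from [g] to [a] will do. *)
    exists (fun m p => if p.2 <= 0 then g m p.1 else a); split.
    - by move=> m z t /= ->.
    - by move=> m z t t1 /=; case: leP => // t0; have := le_trans t1 t0; rewrite ler10.
    - by move=> m p [[_]].
    - by move=> W _; exists 0%N => m z t [].
  have [G GP] := IH (ltnW dn); exact: skel_contraction_step (fill _ dn) GP.
have skT m z : moved m z -> skel n.+1 m z.
  by move=> mz; split=> //; rewrite ltnS /cell_dim (leq_trans (max_card _))// card_ord.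
pose G' m (p : V * R) := if `[< moved m p.1 >] then G m p else a.
have G'a m z t : g m z = a -> G' m (z, t) = a by rewrite /G' => e; case: asboolP.
exists G'; split => //.
- move=> m [z t] W; case: (pselect (moved m z)) => mz.
    rewrite {1}/G' /=; case: asboolP => // _ Wz.
    have mn : \forall p \near (z, t), moved m p.1.
      apply: (cvg_fst (F := nbhs z) (G := nbhs t)).
      by apply: open_nbhs_nbhs; split => //; exact: moved_open.
    have h := Gc m (z, t) (conj (skT _ _ mz) I) W Wz.
    apply: filterS2 mn h => p mp hp; rewrite /G' /=; case: asboolP => // _.
    by apply: hp; split => //; exact: skT.
  rewrite {1}/G' /=; case: asboolP => // _ aW.
  have [N hN] := Gd _ aW; have [K hK] := near_cell_index_bounded m N z.
  (* The finitely many cells of level below [N] near [z] are closed and contained in [moved m];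
     hence a neighbourhood of the unmoved [z] avoids them all. *)
  pose C k : set V := if (pickle_inv k : option (@cell_index n)) is Some (m, (s, c))
    then closed_cell s c else set0.
  have nC : \forall w \near z, forall k : 'I_K, ~ C k z -> ~ C k w.
    suff h (k : 'I_K) : \forall w \near z, ~ C k z -> ~ C k w.
      exact: (filter_forall _ h).
    case: (pselect (C k z)) => h; first by near=> w.
    have : \forall w \near z, ~ C k w.
      apply: open_nbhs_nbhs; split => //; apply: closed_openC; rewrite /C.
      by case: (pickle_inv k) => [[m' [s c]]|]; [exact: closed_cell_closed|exact: closed0].
    by apply: filterS => w.
  have nw : \forall w \near z, moved m w -> (N <= lev m w)%N.
    near=> w; move=> mw; rewrite leqNgt; apply/negP => lw.
    have hk : (pickle ((m, (lev m w, cell m w)) : cell_index) < K)%N by apply: (near hK w).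
    have := near nC w _ (Ordinal hk); rewrite /C /= pickleK_inv; apply.
    - by [].
    - by move=> /(closed_cell_sub _ (moved_open m) _ mw).
    - exact: closed_cell_code.
  have nw' : \forall p \near (z, t), moved m p.1 -> (N <= lev m p.1)%N by exact: (cvg_fst nw).
  apply: filterS nw' => -[w u] hw; rewrite /G' /=; case: asboolP => [mw|_].
    by apply: hN; [exact: skT|apply: Or32; exact: hw].
  exact: nbhs_singleton.
- move=> m z t t0; rewrite /G' /=; case: asboolP => [_|/contrapT ->//]; exact: G0.
- by move=> m z t t1; rewrite /G' /=; case: asboolP => // _; exact: G1.
- split.
    move=> W aW; have [N hN] := Gd _ aW; exists N => m [z t] Nm; rewrite /G'/=.
    case: asboolP => [mz|_]; last exact: nbhs_singleton.
    by apply: hN; [exact: skT|exact: Or31].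
  move=> m W aW; have [N hN] := Gd _ aW; exists N => z t fz; rewrite /G'/=.
  case: asboolP => [mz|_]; last exact: nbhs_singleton.
  by apply: hN; [exact: skT|exact: Or33].
Unshelve. all: by end_near. Qed.

End Family.
End Contraction.

(** * Shrinking wedges of spheres and fillings of cubes *)

Section SumOfSquares.
Context {R : realType} {l : nat}.

Definition sqsum (y : 'rV[R]_l) : R := \sum_i y ord0 i ^+ 2.

Lemma sqsum_ge0 y : 0 <= sqsum y.
Proof. by apply: sumr_ge0 => i _; exact: sqr_ge0. Qed.

Lemma sqsum_continuous : continuous sqsum.
Proof.
rewrite /sqsum; elim: (index_enum _) => [|i s IH] v.
  have -> : (fun v : 'rV[R]_l => \sum_(i <- [::]) v ord0 i ^+ 2) = fun=> 0 :> R.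
    by apply/funext => w; rewrite big_nil.
  exact: cst_continuous.
have -> : (fun v : 'rV[R]_l => \sum_(j <- i :: s) v ord0 j ^+ 2) =
   fun v => v ord0 i * v ord0 i + \sum_(j <- s) v ord0 j ^+ 2 :> R.
  by apply/funext => w; rewrite big_cons expr2.
apply: (@cvgD R R^o _ (nbhs v)); last exact: IH.
by apply: (@cvgM R _ (nbhs v)); exact: coord_continuous.
Qed.

End SumOfSquares.

(** * Radial identification of the round sphere with the boundary of the cube *)

Section Normalization.
Context {R : realType} {k : nat}.
Local Notation V := 'rV[R]_k.+1.
Implicit Types v : V.

Lemma row_norm_ge v i : `|v ord0 i| <= `|v|.
Proof. by rewrite {2}/Num.norm/= mx_normrE; exact: (le_bigmax _ _ (ord0, i)). Qed.

Lemma row_norm_witness v : exists i, `|v| = `|v ord0 i|.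
Proof.
have [v0|v0] := eqVneq v 0.
  by exists ord0; rewrite v0 mxE !normr0.
have [[i j] /= e] : exists i, `|v| = `|v i.1 i.2|.
  by apply: mx_norm_neq0; move: v0; apply: contra => /eqP/mx_norm_eq0 ->.
by exists j; rewrite e (ord1 i).
Qed.

(** The norm of row vectors is the maximum norm, whose unit sphere is the boundary of the cube. *)
Lemma cube_bdE v : cube_bd k v <-> `|v| = 1.
Proof.
split=> [[h1 [i hi]]|h].
  apply/eqP; rewrite eq_le; apply/andP; split.
    by have [j ->] := row_norm_witness v; rewrite ler_norml.
  by apply: le_trans (row_norm_ge v i); case: hi => ->; rewrite ?normrN1 ?normr1.
split=> [i|]; first by rewrite -ler_norml -h row_norm_ge.
have [i e] := row_norm_witness v; exists i; move: e; rewrite h => /esym/eqP.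
by rewrite eqr_norml ler01 andbT => /orP[] /eqP ->; [left|right].
Qed.

Definition l2norm v : R := Num.sqrt (sqsum v).
Definition l2unit v := (l2norm v)^-1 *: v.
Definition sup_unit v := `|v|^-1 *: v.

Lemma l2norm_gt0 v : v != 0 -> 0 < l2norm v.
Proof.
move=> v0; rewrite sqrtr_gt0 lt_neqAle eq_sym sqsum_ge0 andbT.
apply: contra v0; rewrite psumr_eq0; last by move=> i _; exact: sqr_ge0.
move=> /allP h; apply/eqP/rowP => i; rewrite mxE.
by have := h i; rewrite mem_index_enum sqrf_eq0 /= => /(_ isT)/eqP.
Qed.

Lemma sqsum_l2unit v : v != 0 -> sqsum (l2unit v) = 1.
Proof.
move=> v0; have h := l2norm_gt0 _ v0.
rewrite /sqsum; under eq_bigr do rewrite mxE exprMn.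
rewrite -mulr_sumr -/(sqsum v).
have -> : sqsum v = l2norm v ^+ 2 by rewrite sqr_sqrtr// sqsum_ge0.
by rewrite -exprMn mulVf ?expr1n// gt_eqF.
Qed.

Lemma l2norm_continuous : continuous l2norm.
Proof.
move=> v; apply: (@continuous_comp _ _ _ sqsum); first exact: sqsum_continuous.
exact: realfun.sqrt_continuous.
Qed.

Lemma l2unit_cvg v : v != 0 -> l2unit w @[w --> v] --> l2unit v.
Proof.
move=> v0; apply: (@cvgZ R V _ (nbhs v)); last exact: cvg_id.
by apply: (@cvgV R _ (nbhs v)); [rewrite gt_eqF// l2norm_gt0|exact: l2norm_continuous].
Qed.

Lemma sup_unit_cvg v : v != 0 -> sup_unit w @[w --> v] --> sup_unit v.
Proof.
move=> v0; apply: (@cvgZ R V _ (nbhs v)); last exact: cvg_id.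
by apply: (@cvgV R _ (nbhs v)); [rewrite normr_eq0|exact: norm_continuous].
Qed.

Lemma sup_unit_bd v : v != 0 -> cube_bd k (sup_unit v).
Proof.
by move=> v0; apply/cube_bdE; rewrite mx_normZ normfV normr_id mulVf// normr_eq0.
Qed.

Lemma sup_unitZ c v : 0 < c -> sup_unit (c *: v) = sup_unit v.
Proof.
move=> c0; rewrite /sup_unit mx_normZ gtr0_norm// invfM scalerA mulrAC mulVf ?gt_eqF//.
by rewrite mul1r.
Qed.

Lemma sup_unit_l2unit v : cube_bd k v -> sup_unit (l2unit v) = v.
Proof.
move=> /cube_bdE v1; have v0 : v != 0 by rewrite -normr_eq0 v1 oner_eq0.
by rewrite sup_unitZ ?invr_gt0 ?l2norm_gt0// /sup_unit v1 invr1 scale1r.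
Qed.

End Normalization.

(** * The unit interval, tubes and convergence of maps *)

Section UnitInterval.

Lemma I01_clamp_in (r : RR) : clamp01 r \in (`[0, 1]%classic : set RR).
Proof. by rewrite inE /= in_itv/=; exact: clamp01_itv. Qed.

(** A retraction of the line onto [I01]; it lets formulas for time changes take arbitrary real
    values. *)
Definition I01_clamp (r : RR) : I01 := @exist _ (fun r => r \in `[0, 1]%classic) _ (I01_clamp_in r).

Lemma I01_clampE (r : RR) : set_val (I01_clamp r) = clamp01 r.
Proof. by []. Qed.

Lemma I01_itv (t : I01) : 0 <= set_val t <= 1.
Proof. by case: t => t tI /=; have := set_mem tI; rewrite /= in_itv/=. Qed.

Lemma I01_clampK (t : I01) : I01_clamp (set_val t) = t.
Proof. by apply/val_inj => /=; rewrite clamp01_id//; exact: I01_itv. Qed.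

Lemma I01_clamp_continuous : continuous I01_clamp.
Proof. by apply: continuous_comp_initial; exact: clamp01_continuous. Qed.

Lemma set_val_continuous {T : topologicalType} (S : set T) :
  continuous (set_val : S -> T).
Proof. exact: initial_continuous. Qed.

Lemma I01_compact : compact [set: I01].
Proof.
have -> : [set: I01] = I01_clamp @` `[0, 1]%classic.
  apply/seteqP; split => // t _; exists (set_val t); last exact: I01_clampK.
  by rewrite /= in_itv/=; exact: I01_itv.
apply: continuous_compact; last exact: segment_compact.
exact/continuous_subspaceT/I01_clamp_continuous.
Qed.

End UnitInterval.

(** The tube lemma for the compact interval. *)
Lemma near_all_times {K A : topologicalType} (H : (K * I01)%type -> A) (b : K) W :
  continuous H -> (forall t, nbhs (H (b, t)) W) ->
  \forall z \near b, forall t, W (H (z, t)).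
Proof.
move=> cH hW; have /compact_near_coveringP cI := I01_compact.
have h : \forall z \near b, [set: I01] `<=` (fun t => W (H (z, t))).
  apply: cI => t _; have [[P Q] /= [hP hQ] sub] := cH (b, t) W (hW t).
  by exists (Q, P) => // -[u z] /= [Qu Pz]; exact: (sub (z, u)).
by apply: filterS h => z hz t; exact: hz.
Qed.

Lemma finite_set_nat_bounded (S : set nat) :
  finite_set S <-> exists N, forall m, S m -> (m < N)%N.
Proof.
split=> [/finite_seqP[s ->]|[N hN]].
  exists (\max_(i <- s) i).+1 => m /= ms; rewrite ltnS.
  by rewrite (big_rem m)//= leq_max leqnn.
apply: (@sub_finite_set _ _ `I_N) => //; exact: finite_II.
Qed.

Lemma maps_converge_toP {Z Y : topologicalType} (f : nat -> Z -> Y) y :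
  maps_converge_to f y <->
  forall W, nbhs y W -> exists N, forall m z, (N <= m)%N -> W (f m z).
Proof.
split=> h W /h.
  move=> /finite_set_nat_bounded[N hN]; exists N => m z Nm.
  apply: contrapT => nW; have : (m < N)%N.
    by apply: hN => /= sub; apply: nW; apply: sub; exists z.
  by rewrite ltnNge Nm.
move=> [N hN]; apply/finite_set_nat_bounded; exists N => m /= nsub.
by rewrite ltnNge; apply/negP => Nm; apply: nsub => _ [z _ <-]; exact: hN.
Qed.

Lemma maps_converge_comp {Z Y1 Y2 : topologicalType} (f : nat -> Z -> Y1) (h : Y1 -> Y2) y :
  {for y, continuous h} -> maps_converge_to f y ->
  maps_converge_to (fun m => h \o f m) (h y).
Proof.
move=> ch /maps_converge_toP hf; apply/maps_converge_toP => W hW.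
by have [N hN] := hf _ (ch W hW); exists N => m z Nm; exact: hN.
Qed.

(** * Maps and homotopies on shrinking wedges *)

Section SphereWedge.
Variable k : nat.
Local Notation S := (sphere k).
Local Notation b := (sphere_base k).
Local Notation lift := (swedge_lift k).

Lemma sphere_val_inj (u v : S) : set_val u = set_val v -> u = v.
Proof. by move=> /val_inj. Qed.

Lemma sphere_base_closed : closed [set b].
Proof.
apply: accessible_closed_set1; apply: hausdorff_accessible.
move=> u v uv; apply: sphere_val_inj.
apply: (@norm_hausdorff _ 'rV[RR]_k.+1) => P Q hP hQ.
have hP' : nbhs u (set_val @^-1` P) by exact: set_val_continuous.
have hQ' : nbhs v (set_val @^-1` Q) by exact: set_val_continuous.
by have [w [? ?]] := uv _ _ hP' hQ'; exists (set_val w).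
Qed.

Lemma swedge_lift_base m : lift m b = swedge_pt k.
Proof. exact: (@wedge_liftE _ (fun=> S) (fun=> b) 0%N b m b). Qed.

Lemma swedge_surj (z : swedge_carrier k) : exists m u, z = lift m u.
Proof.
have : [set: swedge_carrier k] z by [].
by rewrite -wedgeTE => -[m _ [u _ <-]]; exists m, u.
Qed.

(** The function [f] records index and point off the base point and [None] at it; it is compatible
    with the gluing, hence separates the points of the wedge. *)
Lemma swedge_lift_inj m m' u u' : u <> b -> lift m u = lift m' u' -> m = m' /\ u = u'.
Proof.
move=> ub e; pose f (i : nat) (v : S) := if v == b then None else Some (i, v).
have fE i j : f i b = f j b by rewrite /f eqxx.
have h i v : wedge_fun f (lift i v) = f i v by exact: wedge_lift_funE.
move: (h m u); rewrite e h /f (negbTE (introN eqP ub)).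
by case: ifP => // _ [-> ->].
Qed.

Lemma swedge_lift_continuous m : continuous (lift m : S -> shrinking_wedge k).
Proof. by apply/continuousP => U [oU _]; exact: oU. Qed.

Lemma swedge_shrink W : nbhs (swedge_pt k : shrinking_wedge k) W ->
  exists N, forall m u, (N <= m)%N -> W (lift m u).
Proof.
rewrite nbhsE => -[U [[_ fU] Ub] UW].
have /finite_set_nat_bounded[N hN] := fU Ub; exists N => m u Nm.
apply: UW; apply: contrapT => nU; have : (m < N)%N.
  by apply: hN => /= sub; apply: nU; apply: sub; exists u.
by rewrite ltnNge Nm.
Qed.

(** Off the wedge point, continuity holds because punctured spheres are open in the wedge; at the
    wedge point it follows from the tube lemma on each sphere and the convergence of [F]. *)
Lemma swedge_glue {A : topologicalType} (a : A) (F : nat -> (S * I01)%type -> A) :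
  (forall m, continuous (F m)) -> (forall m t, F m (b, t) = a) ->
  maps_converge_to F a ->
  exists H : (shrinking_wedge k * I01)%type -> A, continuous H /\
    forall m u t, H (lift m u, t) = F m (u, t).
Proof.
move=> cF Fb /maps_converge_toP F0.
pose H (p : (shrinking_wedge k * I01)%type) : A := wedge_fun (fun m u => F m (u, p.2)) p.1.
have HE m u t : H (lift m u, t) = F m (u, t).
  by rewrite /H /= [LHS]wedge_lift_funE// => i j; rewrite !Fb.
exists H; split => // -[z t] W; have [m [u ->]] := swedge_surj z.
have [->|ub] := pselect (u = b).
  rewrite HE Fb swedge_lift_base => aW.
  pose D : set (shrinking_wedge k) := [set z | forall t, W° (H (z, t))].
  have Db : D (swedge_pt k).
    by move=> t'; rewrite -(swedge_lift_base 0) HE Fb; exact: nbhs_singleton (nbhs_interior aW).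
  have oD : open D.
    split=> [i|_].
      rewrite openE => v /= Dv; rewrite /interior.
      have : \forall w \near v, forall t, W° (F i (w, t)).
        apply: near_all_times => // t'; have := Dv t'; rewrite HE => h.
        exact: nbhs_interior.
      by apply: filterS => w hw t'; rewrite HE.
    apply/finite_set_nat_bounded.
    have [N hN] := F0 _ (nbhs_interior aW); exists N => i /= nsub.
    rewrite ltnNge; apply/negP => Ni; apply: nsub => _ [v _ <-] t'.
    by rewrite HE; exact: hN.
  exists (D, setT); first by split; [exact: open_nbhs_nbhs|exact: filterT].
  by move=> [z' t'] /= [Dz _]; apply: interior_subset; exact: Dz.
rewrite HE => Wz; have [[P Q] /= [hP hQ] sub] := cF m (u, t) W Wz.
pose E : set (shrinking_wedge k) := lift m @` (P° `&` ~` [set b]).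
have oE : open E.
  split=> [i|[v [_ /= vb] /esym e]]; last first.
    by have [_ /vb] := swedge_lift_inj m 0 v b vb (esym e).
  have [<-|mi] := pselect (m = i).
    rewrite (_ : lift m @^-1` E = P° `&` ~` [set b]).
      by apply: openI; [exact: open_interior|exact: closed_openC sphere_base_closed].
    apply/seteqP; split => [v [w [Pw wb] e]|v Pv]; last by exists v.
    by have [_ <-] := swedge_lift_inj _ _ _ _ wb e.
  rewrite (_ : lift i @^-1` E = set0); first exact: open0.
  apply/seteqP; split => // v [w [Pw wb] e].
  by have [] := swedge_lift_inj _ _ _ _ wb e.
exists (E, Q).
  split => //; apply: open_nbhs_nbhs; split => //; exists u => //; split => //.
move=> [z' t'] /= [[v [Pv _] <-] Qt]; rewrite HE; apply: (sub (v, t')).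
by split => //; exact: interior_subset.
Qed.

End SphereWedge.

(** * The space of reciprocals as a convergent sequence *)

Section HarmonicPoints.

Lemma H0_pt_in (m : nat) : (m.+1%:R^-1 : RR) \in H0_set.
Proof. by apply/mem_set; right; exists m. Qed.

Definition H0_pt (m : nat) : H0 := @exist _ (fun r => r \in H0_set) _ (H0_pt_in m).

Lemma H0_cases (z : H0) : z = H0_base \/ exists m, z = H0_pt m.
Proof.
case: z => r rH; have /set_mem[r0|[m rm]] := rH.
  by left; apply/val_inj.
by right; exists m; apply/val_inj.
Qed.

Lemma H0_pt_inj : injective H0_pt.
Proof.
move=> m m' /(congr1 val)/= /invr_inj/eqP; rewrite eqr_nat => /eqP[].
by [].
Qed.

Lemma H0_pt_neq m : H0_pt m <> H0_base.
Proof. by move=> /(congr1 val)/= /eqP; rewrite invr_eq0 pnatr_eq0. Qed.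

Lemma H0_nbhs (W : set H0) : nbhs H0_base W <->
  W H0_base /\ exists N, forall m, (N <= m)%N -> W (H0_pt m).
Proof.
split=> [h|[Wb [N hN]]].
  split; first exact: nbhs_singleton.
  move: h; rewrite nbhsE => -[_ [[O oO <-] /= O0] OW].
  have /nbhs_ballP[e /= e0 be] : nbhs (0 : RR) O by exact: open_nbhs_nbhs.
  exists (Num.truncn e^-1) => m hm; apply: OW; apply: be; rewrite /ball /= sub0r normrN.
  rewrite gtr0_norm ?invr_gt0// invf_plt ?posrE//.
  by rewrite (lt_le_trans (truncnS_gt _))// ler_nat.
have h0 : nbhs (0 : RR) [set r | r < N.+1%:R^-1] by apply: lt_nbhsl; rewrite invr_gt0.
have h : \forall z \near H0_base, (set_val z : RR) < N.+1%:R^-1.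
  exact: (set_val_continuous _ H0_base _ h0).
apply: filterS h => z /=.
have [->//|[m ->]] := H0_cases z; rewrite /= ltf_pV2 ?posrE// ltr_nat ltnS => /ltnW.
exact: hN.
Qed.

Lemma H0_pt_isolated m (W : set H0) : W (H0_pt m) -> nbhs (H0_pt m) W.
Proof.
move=> Wm; have m0 : (0 : RR) < m.+1%:R^-1 by rewrite invr_gt0.
have h1 : nbhs (m.+1%:R^-1 : RR) [set r | m.+2%:R^-1 < r].
  by apply: lt_nbhsr; rewrite ltf_pV2 ?posrE// ltr_nat.
(* The upper bound is put on [r^-1] so that [m = 0], where [1 / m] is no bound, is included. *)
have h2 : nbhs (m.+1%:R^-1 : RR) [set r | 0 < r -> r^-1 > m%:R].
  have : nbhs (m.+1%:R^-1 : RR) [set r | r * m%:R < 1].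
    case: (posnP m) => [->|mpos].
      by apply: (@filterS _ _ _ setT) => [r _ /=|]; [rewrite mulr0|exact: filterT].
    apply: (@filterS _ _ _ [set r | r < m%:R^-1]) => [r /=|].
      by rewrite -[m%:R^-1]div1r ltr_pdivlMr ?ltr0n.
    by apply: lt_nbhsl; rewrite ltf_pV2 ?posrE ?ltr0n// ltr_nat.
  by apply: filterS => r /= h r0; rewrite -[X in _ < X]mul1r ltr_pdivlMr// mulrC.
have h : \forall z \near H0_pt m, ([set r | m.+2%:R^-1 < r] `&`
    [set r | 0 < r -> r^-1 > m%:R]) (set_val z : RR).
  exact: (set_val_continuous _ (H0_pt m) _ (filterI h1 h2)).
apply: filterS h => z /=; have [->|[m' ->]] := H0_cases z => /=.
  by rewrite ltNge invr_ge0 ler0n => -[].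
rewrite ltf_pV2 ?posrE// ltr_nat invr_gt0 ltr0n invrK ltr_nat !ltnS => -[h h'].
suff -> : m' = m by [].
by apply/eqP; rewrite eqn_leq h/= h'.
Qed.

Lemma H0_glue {A : topologicalType} (a : A) (F : nat -> I01 -> A) :
  (forall m, continuous (F m)) -> maps_converge_to F a ->
  exists H : (H0 * I01)%type -> A, [/\ continuous H,
    forall t, H (H0_base, t) = a & forall m t, H (H0_pt m, t) = F m t].
Proof.
move=> cF /maps_converge_toP F0.
pose H (p : (H0 * I01)%type) : A :=
  match pselect (exists m, p.1 = H0_pt m) with
  | left e => F (projT1 (cid e)) p.2
  | right _ => a
  end.
have Hb t : H (H0_base, t) = a.
  rewrite /H /=; case: pselect => // -[m e].
  by case: (H0_pt_neq m); exact: esym.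
have Hp m t : H (H0_pt m, t) = F m t.
  rewrite /H /=; case: pselect => [e|[]]; last by exists m.
  by case: (cid e) => m' /= /H0_pt_inj ->.
exists H; split => // -[z t] W; have [->|[m ->]] := H0_cases z.
  rewrite Hb => aW; pose D : set H0 := [set z | forall t, W (H (z, t))].
  exists (D, setT) => [|[z' t'] /= []//]; split; last exact: filterT.
  apply/H0_nbhs; split; first by move=> t'; rewrite Hb; exact: nbhs_singleton.
  have [N hN] := F0 _ aW; exists N => m Nm t'; rewrite Hp; exact: hN.
rewrite Hp => Wm; exists ([set H0_pt m], [set t | W (F m t)]).
  by split; [exact: H0_pt_isolated|exact: cF].
by move=> [z' t'] /= [-> Wt]; rewrite Hp.
Qed.

End HarmonicPoints.

(** * Based homotopy as an equivalence relation *)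

Section BasedHomotopy.
Context {K X : topologicalType} (b : K) (x : X).
Implicit Types f g h : K -> X.

Lemma paste_continuous {T U : topologicalType} (f g : T -> U) (l : T -> RR) (c : RR) :
  continuous f -> continuous g -> continuous l -> (forall p, l p = c -> f p = g p) ->
  continuous (fun p => if l p <= c then f p else g p).
Proof.
move=> cf cg cl e p W /= Wp.
have [lt|gt|eq] := ltgtP (l p) c.
- have n1 : \forall q \near p, l q < c := cl p _ (lt_nbhsl lt).
  have n2 : \forall q \near p, W (f q) by apply: (cf p W); move: Wp; rewrite ltW.
  by apply: filterS2 n1 n2 => q /ltW /= ->.
- have n1 : \forall q \near p, c < l q := cl p _ (lt_nbhsr gt).
  have n2 : \forall q \near p, W (g q) by apply: (cg p W); move: Wp; rewrite leNgt gt.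
  by apply: filterS2 n1 n2 => q /=; rewrite ltNge => /negbTE ->.
- have n1 : \forall q \near p, W (f q) by apply: (cf p W); move: Wp; rewrite eq lexx.
  have n2 : \forall q \near p, W (g q).
    by apply: (cg p W); rewrite -e//; move: Wp; rewrite eq lexx.
  by apply: filterS2 n1 n2 => q /= ? ?; case: ifP.
Qed.

Lemma time_change_continuous (H : (K * I01)%type -> X) (c d : RR) : continuous H ->
  continuous (fun p : (K * I01)%type => H (p.1, I01_clamp (c * set_val p.2 + d))).
Proof.
move=> cH p; apply: (@continuous_comp _ _ _
  (fun p : (K * I01)%type => (p.1, I01_clamp (c * set_val p.2 + d)))); last exact: cH.
move: p; apply: continuous_pair => p; first exact: cvg_fst.
apply: (@continuous_comp _ _ _ (fun p : (K * I01)%type => c * set_val p.2 + d)).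
  apply: continuous_affine => q; apply: (@continuous_comp _ _ _ snd set_val).
    exact: cvg_snd.
  exact: set_val_continuous.
exact: I01_clamp_continuous.
Qed.

Lemma based_homotopic_sym f g : based_homotopic b x f g -> based_homotopic b x g f.
Proof.
move=> [H [cH [H0' [H1 Hb]]]].
exists (fun p => H (p.1, I01_clamp ((-1) * set_val p.2 + 1))).
split; first exact: time_change_continuous.
split=> [z t t0|]; first by apply: H1; rewrite I01_clampE /= t0 mulr0 add0r clamp01_ge1.
split=> [z t t1|t]; last exact: Hb.
by apply: H0'; rewrite I01_clampE /= t1 mulr1 addNr clamp01_le0.
Qed.

Lemma based_homotopic_trans f g h :
  based_homotopic b x f g -> based_homotopic b x g h -> based_homotopic b x f h.
Proof.
move=> [H [cH [H0' [H1 Hb]]]] [G [cG [G0 [G1 Gb]]]].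
exists (fun p => if (set_val p.2 : RR) <= 2^-1
  then H (p.1, I01_clamp (2 * set_val p.2 + 0))
  else G (p.1, I01_clamp (2 * set_val p.2 + (-1)))).
split.
  apply: paste_continuous.
  - exact: time_change_continuous.
  - exact: time_change_continuous.
  - move=> p; apply: (@continuous_comp _ _ _ snd set_val); first exact: cvg_snd.
    exact: set_val_continuous.
  - move=> [z t] /= e; rewrite H1 ?G0//= I01_clampE e mulfV ?addr0 ?subrr ?pnatr_eq0//.
      by rewrite clamp01_le0.
    by rewrite clamp01_ge1.
split=> [z t t0|].
  by rewrite /= t0 invr_ge0 ler0n; apply: H0'; rewrite I01_clampE mulr0 addr0 clamp01_le0.
split=> [z t t1|t]; last by rewrite /=; case: ifP.
rewrite /= t1 leNgt invf_lt1 ?ltr1n//=; apply: G1.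
by rewrite I01_clampE mulr1 clamp01_ge1//; lra.
Qed.

Lemma based_homotopic_refl f : based_maps b x f -> based_homotopic b x f f.
Proof.
move=> [cf fb]; exists (f \o fst); split; last by split.
move=> p; apply: (@continuous_comp _ _ _ fst f); first exact: cvg_fst.
exact: cf.
Qed.

Lemma based_maps_cst : based_maps b x (fun=> x).
Proof. by split => //; exact: cst_continuous. Qed.

(** The constant map is always a based map, so a unique class is its class. *)
Lemma based_htpy_classes_singleton :
  (exists C, based_htpy_classes b x = [set C]) <->
  forall f, based_maps b x f -> based_homotopic b x f (fun=> x).
Proof.
split=> [[C e] f bf|h].
  have cls g : based_maps b x g ->
      [set g' | based_maps b x g' /\ based_homotopic b x g g'] = C.
    move=> bg; have : based_htpy_classes b x
      [set g' | based_maps b x g' /\ based_homotopic b x g g'] by exists g.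
    by rewrite e.
  have [] : [set g' | based_maps b x g' /\ based_homotopic b x f g'] (fun=> x).
    rewrite cls// -(cls _ based_maps_cst); split; first exact: based_maps_cst.
    exact: based_homotopic_refl based_maps_cst.
  by [].
exists (based_maps b x); apply/seteqP; split => [_ [f bf <-]|_ ->].
  apply/seteqP; split => [g []//|g bg]; split => //.
  by apply: based_homotopic_trans (h _ bf) _; apply: based_homotopic_sym; exact: h.
exists (fun=> x); first exact: based_maps_cst.
apply/seteqP; split => [g []//|g bg]; split => //.
by apply: based_homotopic_sym; exact: h.
Qed.

End BasedHomotopy.

(** * From sequential connectedness to fillings *)

Section Fillable.

Definition sphere_unit {k : nat} (v : 'rV[RR]_k.+1) : sphere k :=
  insubd (sphere_base k) (l2unit v).

Lemma sphere_unitE k (v : 'rV[RR]_k.+1) : v != 0 -> set_val (sphere_unit v) = l2unit v.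
Proof. by move=> v0; apply: insubdK; apply/mem_set; exact: sqsum_l2unit. Qed.

Lemma near_neq0 {R : realType} k (v : 'rV[R]_k) : v != 0 -> \forall w \near v, w != 0.
Proof.
move=> v0; have h : nbhs v (~` [set 0]).
  apply: open_nbhs_nbhs; split; last exact/eqP.
  apply: closed_openC; apply: accessible_closed_set1; apply: hausdorff_accessible.
  exact: norm_hausdorff.
by apply: filterS h => w /eqP.
Qed.

Lemma sphere_unit_cvg k (v : 'rV[RR]_k.+1) : v != 0 ->
  {for v, continuous (@sphere_unit k)}.
Proof.
move=> v0 W; rewrite {1}nbhsE => -[_ [[O oO <-] /= Ov] OW].
have n1 : \forall w \near v, O (l2unit w).
  by apply: (l2unit_cvg v v0); apply: open_nbhs_nbhs; split; rewrite // -sphere_unitE.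
have n2 := near_neq0 _ v v0.
by apply: filterS2 n1 n2 => w Ow w0; apply: OW; rewrite /= sphere_unitE.
Qed.

Lemma sphere_val_neq0 k (u : sphere k) : set_val u != 0 :> 'rV[RR]_k.+1.
Proof.
apply/eqP => u0; have /set_mem : set_val u \in sphere_set k by exact: (valP u).
rewrite /sphere_set/= u0 big1 => [/eqP|i _]; first by rewrite eq_sym oner_eq0.
by rewrite mxE expr0n.
Qed.

(** The boundary maps assemble into one map on [Hk d], and a based null-homotopy of it is coned off
    cube by cube. Since it fixes the base point at all times, the tube lemma makes the fillings
    converge to [a]. For [d = 0] the boundary is two points, one sent to [a], and the fillings are
    paths. *)
Lemma fillable_of_connected {A : topologicalType} (a : A) n d :
  seq_n_connected_at A a n -> (d <= n)%N -> fillable RR a d.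
Proof.
move=> cA dn phi cphi phi1 phi0.
have /based_htpy_classes_singleton null := cA d dn.
case: d => [|d] in dn phi cphi phi1 phi0 null *.
  pose v0 : 'rV[RR]_1 := const_mx (-1).
  have bd0 : cube_bd 0 v0.
    by split=> [i|]; [rewrite mxE lexx /=; lra|exists ord0; rewrite mxE; right].
  (* Gluing families that are constant in time just assembles the points into a map on [H0]; the
     spheres below are treated alike. *)
  have [||H [cH Hb Hp]] := @H0_glue A a (fun m _ => phi m v0).
  - by move=> m; exact: cst_continuous.
  - apply/maps_converge_toP => W /phi0[N hN].
    by exists N => m _ Nm; exact: hN.
  have [|G [cG [G0 [G1 Gb]]]] := null (fun z => H (z, I01_clamp 0)).
    split; last exact: Hb.
    move=> z; apply: (@continuous_comp _ _ _ (fun z : H0 => (z, I01_clamp 0)) H).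
      by move: z; apply: continuous_pair; [move=> ?; exact: cvg_id|exact: cst_continuous].
    exact: cH.
  exists (fun m v => G (H0_pt m, I01_clamp (2^-1 * v ord0 ord0 + 2^-1))); split.
  - move=> m v; apply: (@continuous_comp _ _ _ (fun v : 'rV[RR]_1 =>
      (H0_pt m, I01_clamp (2^-1 * v ord0 ord0 + 2^-1))) G); last exact: cG.
    move: v; apply: continuous_pair; first exact: cst_continuous.
    move=> v; apply: (@continuous_comp _ _ _ (fun v : 'rV[RR]_1 => 2^-1 * v ord0 ord0 + 2^-1)).
      by apply: continuous_affine; exact: coord_continuous.
    exact: I01_clamp_continuous.
  - move=> m v bv; have [_ [i]] := bv; rewrite (ord1 i) => -[v1|v1].
      by rewrite phi1// G1// I01_clampE v1 clamp01_ge1//; lra.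
    rewrite G0 ?I01_clampE ?v1 ?clamp01_le0//; last by lra.
    rewrite Hp; congr (phi m _); apply/rowP => j; rewrite (ord1 j) mxE v1.
    by [].
  - move=> W aW.
    have /H0_nbhs[_ [N hN]] : \forall z \near H0_base, forall t, W (G (z, t)).
      by apply: (@near_all_times H0 A G H0_base W cG) => t; rewrite (Gb t).
    by exists N => m v Nm; exact: hN.
pose F m (p : (sphere d.+1 * I01)%type) := phi m (sup_unit (set_val p.1)).
(* The base vector lies on the face that [phi] sends to [a], so the maps on the spheres are
   based. *)
have base1 : cube_bd d.+1 (sphere_base_vec d.+1).
  split=> [i|]; last by exists ord0; left; rewrite mxE eqxx.
  by rewrite mxE; case: (_ == _) => /=; lra.
have cF m : continuous (F m).
  move=> [u t] W Wu; have u0 := sphere_val_neq0 _ u.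
  have h := cphi m _ (sup_unit_bd _ u0) W Wu.
  have n1 : \forall w \near (set_val u : 'rV[RR]_d.+2),
    cube_bd d.+1 (sup_unit w) -> W (phi m (sup_unit w)) := sup_unit_cvg _ u0 _ h.
  have n2 : \forall w \near u, cube_bd d.+1 (sup_unit (set_val w)) ->
    W (phi m (sup_unit (set_val w))) := set_val_continuous _ u _ n1.
  have n3 : \forall p \near (u, t), cube_bd d.+1 (sup_unit (set_val p.1)) ->
    W (phi m (sup_unit (set_val p.1))) by exact: (cvg_fst n2).
  suff : \forall p \near (u, t), W (F m p) by [].
  by apply: filterS n3 => p; apply; apply: sup_unit_bd; exact: sphere_val_neq0.
have Fb m t : F m (sphere_base d.+1, t) = a.
  rewrite /F /sup_unit /= (_ : set_val _ = sphere_base_vec d.+1)//.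
  have /cube_bdE -> := base1; rewrite invr1 scale1r phi1//.
  by rewrite mxE eqxx.
have F0 : maps_converge_to F a.
  apply/maps_converge_toP => W /phi0[N hN]; exists N => m [u t] Nm.
  by apply: hN => //; apply: sup_unit_bd; exact: sphere_val_neq0.
have [H [cH HE]] := swedge_glue _ a F cF Fb F0.
have [|G [cG [G0 [G1 Gb]]]] := null (fun z => H (z, I01_clamp 0)).
  split; last by rewrite /= -(swedge_lift_base _ 0) HE Fb.
  move=> z; apply: (@continuous_comp _ _ _
    (fun z : shrinking_wedge d.+1 => (z, I01_clamp 0)) H); last exact: cH.
  by move: z; apply: continuous_pair; [move=> ?; exact: cvg_id|exact: cst_continuous].
(* Polar coordinates: direction gives the point of the sphere, radius the time. [2 - 2 |v|] is [0]
   on the boundary and at least [1] for [|v| <= 1/2], so the filling is constantly [a] near the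
   origin, where no direction is defined. *)
pose E m (v : 'rV[RR]_d.+2) : A := G (swedge_lift d.+1 m (sphere_unit v),
                 I01_clamp ((-2) * `|v| + 2)).
exists (fun m v => if v == 0 then a else E m v); split.
- move=> m v; have [->|v0] := eqVneq v 0.
    move=> W; rewrite eqxx => aW.
    have n1 : \forall w \near (0 : 'rV[RR]_d.+2), `|w| < 2^-1.
      apply: (@norm_continuous _ 'rV[RR]_d.+2 0 [set r | r < 2^-1]).
      by apply: lt_nbhsl; rewrite normr0 invr_gt0.
    apply: filterS n1 => w hw /=; case: eqP => _; first exact: nbhs_singleton.
    rewrite /E G1; first exact: nbhs_singleton.
    by rewrite I01_clampE clamp01_ge1//; lra.
  move=> W; rewrite (negbTE v0) => Wv.
  have cE : {for v, continuous (E m)}.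
    apply: (@continuous_comp _ (shrinking_wedge d.+1 * I01)%type _
      (fun v : 'rV[RR]_d.+2 => (swedge_lift d.+1 m (sphere_unit v) : shrinking_wedge d.+1,
         I01_clamp ((-2) * `|v| + 2))) G); last exact: cG.
    apply: continuous_pair_at.
      apply: (@continuous_comp _ _ _ sphere_unit (swedge_lift d.+1 m : _ -> shrinking_wedge d.+1)).
        exact: sphere_unit_cvg.
      exact: swedge_lift_continuous.
    apply: (@continuous_comp _ _ _ (fun v : 'rV[RR]_d.+2 => (-2) * `|v| + 2) I01_clamp).
      by apply: continuous_affine; exact: norm_continuous.
    exact: I01_clamp_continuous.
  have n1 : \forall w \near v, W (E m w) := cE W Wv.
  by apply: filterS2 n1 (near_neq0 _ v v0) => w Ww /= /negbTE ->.
- move=> m v bv; have /cube_bdE v1 := bv.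
  have v0 : v != 0 by rewrite -normr_eq0 v1 oner_eq0.
  rewrite (negbTE v0) /E G0; last by rewrite I01_clampE v1 clamp01_le0//; lra.
  by rewrite HE /F /= sphere_unitE// sup_unit_l2unit.
- move=> W aW.
  have /swedge_shrink[N hN] : \forall z \near (swedge_pt d.+1 : shrinking_wedge d.+1),
      forall t, W (G (z, t)).
    by apply: (@near_all_times (shrinking_wedge d.+1) A G _ W cG) => t; rewrite (Gb t).
  exists N => m v Nm; case: eqP => _; first exact: nbhs_singleton.
  exact: hN.
Qed.

End Fillable.

(** * The topology of the adjunction space *)

Section AdjTopology.
Variables (X : topologicalType) (x : nat -> X).
Variables (A : nat -> topologicalType) (a : forall j, A j).
Local Notation Y := (Adj X x A a).
Local Notation r := (adj_retr X x A a).
Local Notation summ := (adj_sum X A).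
Local Notation fam := (adj_fam X A).
Local Notation famk := (adjk_fam X A).
Local Notation pi_k k := (\pi_(Yk X x A a k)%qT).

(** The collapse onto [A j]: [dfwith a y] is the family of base points with [y] put in at place
    [i]. *)
Definition adj_proj_sum (j : nat) (p : summ) : A j :=
  match p with
  | existT o y =>
    match o return fam o -> A j with
    | None => fun _ => a j
    | Some i => fun y => eqtype.dfwith a y j
    end y
  end.

Definition adj_proj (j : nat) (c : Y) : A j := adj_proj_sum j (repr c).

Definition adj_pt (p : summ) : Y := \pi_(adj_set X x A a)%qT p.

Lemma dfwith_id (i j : nat) : eqtype.dfwith a (a i) j = a j.
Proof. by case: eqtype.dfwithP. Qed.

Lemma dfwith_continuous_at (i j : nat) : continuous (fun y : A i => eqtype.dfwith a y j).
Proof.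
have [<-|ij] := eqVneq i j.
  rewrite (_ : (fun y => _) = id); first by move=> y; exact: cvg_id.
  by apply/funext => y; rewrite eqtype.dfwith_in.
rewrite (_ : (fun y => _) = fun=> a j); first exact: cst_continuous.
by apply/funext => y; rewrite eqtype.dfwith_out.
Qed.

Lemma adj_norm_retr p : adj_retr_sum X x A (adj_norm X x A a p) = adj_retr_sum X x A p.
Proof. by case: p => -[i|] y //=; case: ifP. Qed.

Lemma adj_norm_proj j p : adj_proj_sum j (adj_norm X x A a p) = adj_proj_sum j p.
Proof. by case: p => -[i|] y //=; case: eqP => //= ->; rewrite dfwith_id. Qed.

Lemma repr_adj_pt p :
  adj_norm X x A a (repr (adj_pt p)) = adj_norm X x A a p.
Proof. by apply/eqP; have /eqmodP := reprK (adj_pt p). Qed.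

Lemma adj_retr_pt p : r (adj_pt p) = adj_retr_sum X x A p.
Proof. by rewrite /adj_retr -adj_norm_retr repr_adj_pt adj_norm_retr. Qed.

Lemma adj_proj_pt j p : adj_proj j (adj_pt p) = adj_proj_sum j p.
Proof. by rewrite /adj_proj -adj_norm_proj repr_adj_pt adj_norm_proj. Qed.

Lemma adj_pt_repr (c : Y) : c = adj_pt (repr c).
Proof. by rewrite /adj_pt reprK. Qed.

Lemma adj_pt_norm p : adj_pt (adj_norm X x A a p) = adj_pt p.
Proof.
apply/eqmodP/eqP; case: p => -[i|] y //=.
by case: ifP => //= ->.
Qed.

Lemma adj_pt_proj (c : Y) j : adj_proj j c <> a j ->
  c = adj_pt (existT fam (Some j) (adj_proj j c)) /\ r c = x j.
Proof.
rewrite [c]adj_pt_repr; move: (repr c) => [[i|] y]; rewrite adj_proj_pt adj_retr_pt //=.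
by case: eqtype.dfwithP => // ? ?.
Qed.

Lemma adj_pt_retr (c : Y) : (forall j, adj_proj j c = a j) ->
  c = adj_incl X x A a (r c).
Proof.
rewrite [c]adj_pt_repr; move: (repr c) => [[i|] y]; last by rewrite adj_retr_pt.
move=> /(_ i); rewrite adj_proj_pt adj_retr_pt /= eqtype.dfwith_in => ->.
by rewrite -adj_pt_norm /= eqxx.
Qed.

Lemma adj_retr_incl y : r (adj_incl X x A a y) = y.
Proof. exact: adj_retr_pt. Qed.

Lemma adj_proj_incl j y : adj_proj j (adj_incl X x A a y) = a j.
Proof. exact: adj_proj_pt. Qed.

(** If some projection is off its base point, it determines the point; otherwise the point lies in
    [X] and [r] determines it. *)
Lemma adj_ext (c c' : Y) :
  r c = r c' -> (forall j, adj_proj j c = adj_proj j c') -> c = c'.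
Proof.
move=> e h; have [[j nj]|/forallNP all] := pselect (exists j, adj_proj j c <> a j).
  have [e1 _] := adj_pt_proj _ _ nj; rewrite h in nj.
  by have [e2 _] := adj_pt_proj _ _ nj; rewrite e1 h -e2.
have hc j : adj_proj j c = a j by apply: contrapT; exact: all.
by rewrite (adj_pt_retr c)// e -adj_pt_retr// => j; rewrite -h.
Qed.

Lemma adj_to_kT k j (h : (j < k)%N) (y : A j) :
  adj_to_k X x A k (existT fam (Some j) y) = existT (famk k) (Some (Ordinal h)) y.
Proof.
rewrite /adj_to_k; move: (erefl (j < k)%N); case: {2 3}(j < k)%N => e.
  by rewrite (bool_irrelevance e h).
by exfalso; move: (h); rewrite e.
Qed.

Lemma adj_to_kF k j (y : A j) : (j < k)%N = false ->
  adj_to_k X x A k (existT fam (Some j) y) = existT (famk k) None (x j).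
Proof.
move=> h; rewrite /adj_to_k; move: (erefl (j < k)%N); case: {2 3}(j < k)%N => // e.
by exfalso; rewrite h in e.
Qed.

Lemma pi_k_base k j (jk : (j < k)%N) :
  pi_k k (existT (famk k) (Some (Ordinal jk)) (a j)) = pi_k k (existT (famk k) None (x j)).
Proof. by apply/eqmodP; rewrite /= /adjk_rel' /= eqxx. Qed.

(** With [adj_to_prod_retr] it expresses the coordinate in [Yk k] by [r] and the projections, which
    carries questions about the inverse limit over to these maps. *)
Lemma adj_to_prod_proj k j (jk : (j < k)%N) (c : Y) : adj_proj j c <> a j ->
  adj_to_prod X x A a c k = pi_k k (existT (famk k) (Some (Ordinal jk)) (adj_proj j c)).
Proof.
rewrite /adj_to_prod /adj_proj; case: (repr c) => -[i|] y; rewrite [adj_proj_sum _ _]/=//.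
by case: eqtype.dfwithP jk => // jk _; rewrite adj_to_kT.
Qed.

Lemma adj_to_prod_retr k (c : Y) : (forall j, (j < k)%N -> adj_proj j c = a j) ->
  adj_to_prod X x A a c k = pi_k k (existT (famk k) None (r c)).
Proof.
rewrite /adj_to_prod /adj_proj /adj_retr; case: (repr c) => -[i|] y h //.
have [ik|ik] := ltnP i k; last by rewrite adj_to_kF// ltnNge ik.
have -> : y = a i by have := h i ik; rewrite /= eqtype.dfwith_in.
by rewrite adj_to_kT pi_k_base.
Qed.

Lemma Ytop_fun_continuous k (Z : topologicalType) (g : adjk_sum X A k -> Z) :
  continuous g -> (forall p, g (adjk_norm X x A a k p) = g p) ->
  continuous (g \o repr : Ytop X x A a k -> Z) /\
  forall p, g (repr (pi_k k p)) = g p.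
Proof.
move=> cg gN.
have gE p q : pi_k k p = pi_k k q -> g p = g q.
  by move=> /eqmodP/eqP e; rewrite -(gN p) e gN.
split; last by move=> p; apply: gE; rewrite reprK.
by apply: repr_comp_continuous => // p q /eqP e; apply/eqP; exact: gE.
Qed.

Lemma adj_to_prod_continuous k : continuous (fun c : Y => adj_to_prod X x A a c k).
Proof.
move=> c; apply: (@continuous_comp _ _ _ (adj_to_prod X x A a : Y -> prod_topology (Ytop X x A a))
   (@proj _ (Ytop X x A a) k)); last exact: proj_continuous.
exact: initial_continuous.
Qed.

(** [r] factors through stage [0] of the limit, where every [A j] is collapsed. *)
Lemma adj_retr_continuous : continuous r.
Proof.
pose f (o : option 'I_0) : famk 0 o -> X :=
  match o with None => id | Some j => fun=> x j end.
have [] := Ytop_fun_continuous 0 X (unstable.sigT_fun f).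
- by apply: sigT_continuous => -[j|]; [exact: cst_continuous|move=> y; exact: cvg_id].
- by move=> -[[j|] y]; rewrite /unstable.sigT_fun //=; case: ifP.
move=> cf fE.
have -> : r = (unstable.sigT_fun f \o repr) \o (fun c : Y => adj_to_prod X x A a c 0).
  apply/funext => c /=; rewrite /adj_to_prod fE /adj_retr.
  by case: (repr c) => -[i|] y //; rewrite adj_to_kF.
move=> c; apply: continuous_comp; first exact: adj_to_prod_continuous.
exact: cf.
Qed.

(** The projection factors through stage [j.+1], the first one to contain [A j]. *)
Lemma adj_proj_continuous j : continuous (adj_proj j).
Proof.
pose f (o : option 'I_j.+1) : famk j.+1 o -> A j :=
  match o with None => fun=> a j | Some i => fun y => eqtype.dfwith a y j end.
have [] := Ytop_fun_continuous j.+1 (A j) (unstable.sigT_fun f).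
- apply: sigT_continuous => -[i|]; last exact: cst_continuous.
  exact: dfwith_continuous_at.
- move=> -[[i|] y]; rewrite /unstable.sigT_fun //=; case: eqP => //= ->.
  by rewrite dfwith_id.
move=> cf fE.
have -> : adj_proj j = (unstable.sigT_fun f \o repr) \o (fun c : Y => adj_to_prod X x A a c j.+1).
  apply/funext => c /=; rewrite /adj_to_prod fE /adj_proj.
  case: (repr c) => -[i|] y //; have [ij|ij] := ltnP i j.+1; first by rewrite adj_to_kT.
  rewrite adj_to_kF; last by rewrite ltnNge ij.
  by rewrite /unstable.sigT_fun /= eqtype.dfwith_out// gtn_eqF.
move=> c; apply: continuous_comp; first exact: adj_to_prod_continuous.
exact: cf.
Qed.

Hypothesis a_closed : forall j, closed [set a j].

(* The finitely many [A j] seen by [Yk k] either contain the limit in their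
   punctured part, or are controlled by neighbourhoods of their base points. *)
Lemma adj_cvg_k (F : set_system Y) {FF : Filter F} (c : Y) k :
  (forall V, nbhs (r c) V -> F [set c' | V (r c')]) ->
  (forall j V, nbhs (adj_proj j c) V -> F [set c' | V (adj_proj j c')]) ->
  forall O, open O -> O (adj_to_prod X x A a c k) ->
  F [set c' | O (adj_to_prod X x A a c' k : Ytop X x A a k)].
Proof.
move=> hr hq O oO Oc.
have /sigT_openP oS : open (pi_k k @^-1` O) by exact: oO.
pose V := [set y | O (pi_k k (existT (famk k) None y))].
have oV : open V by exact: (oS None).
pose U j (jk : (j < k)%N) := [set y | O (pi_k k (existT (famk k) (Some (Ordinal jk)) y))].
have oU j jk : open (U j jk) by exact: (oS (Some (Ordinal jk))).
have [[j [jk nj]]|nex] := pselect (exists j, (j < k)%N /\ adj_proj j c <> a j).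
  have : nbhs (adj_proj j c) (U j jk `&` ~` [set a j]).
    apply: open_nbhs_nbhs; split; first by apply: openI; [exact: oU|exact: closed_openC].
    by split => //; rewrite /U /= -adj_to_prod_proj.
  move=> /hq; apply: filterS => c' /= [Uc nc].
  by rewrite (adj_to_prod_proj _ _ jk).
have all j : (j < k)%N -> adj_proj j c = a j.
  by move=> jk; apply: contrapT => nj; apply: nex; exists j.
have Vc : V (r c) by rewrite /V /= -adj_to_prod_retr.
have n1 : F [set c' | V (r c')] by apply: hr; exact: open_nbhs_nbhs.
(* [a j] lies in [U j] exactly when [x j] lies in [V]. A [c'] in the punctured [A j] has
   [r c' = x j], so [V (r c')] supplies the premise for its own summand. *)
have n2 : F [set c' | forall j : 'I_k, U j (ltn_ord j) (a j) -> U j (ltn_ord j) (adj_proj j c')].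
  suff h (j : 'I_k) : F [set c' | U j (ltn_ord j) (a j) -> U j (ltn_ord j) (adj_proj j c')].
    exact: (filter_forall _ h).
  have [Ua|nUa] := pselect (U j (ltn_ord j) (a j)); last by apply: filterS filterT => c' _ /nUa.
  have : nbhs (adj_proj j c) (U j (ltn_ord j)).
    by apply: open_nbhs_nbhs; split; rewrite ?all//; exact: oU.
  by move=> /hq; apply: filterS => c' /=.
apply: filterS2 n1 n2 => c' /= Vc' Uc'.
have [[j [jk nj]]|nex'] := pselect (exists j, (j < k)%N /\ adj_proj j c' <> a j).
  rewrite (adj_to_prod_proj _ _ jk)//; have := Uc' (Ordinal jk).
  rewrite /U /= (bool_irrelevance (ltn_ord (Ordinal jk)) jk); apply.
  by rewrite pi_k_base; have [_ <-] := adj_pt_proj _ _ nj.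
rewrite adj_to_prod_retr// => j jk; apply: contrapT => nj; apply: nex'.
by exists j.
Qed.

(** With the continuity of [r] and the projections, this makes the topology initial for them.
    Filters cover both continuity and convergence of sequences of maps. *)
Lemma adj_cvg (F : set_system Y) {FF : Filter F} (c : Y) :
  (forall V, nbhs (r c) V -> F [set c' | V (r c')]) ->
  (forall j V, nbhs (adj_proj j c) V -> F [set c' | V (adj_proj j c')]) ->
  forall U, nbhs c U -> F U.
Proof.
move=> hr hq U; rewrite nbhsE => -[_ [[O oO <-] /= Oc] OU].
apply: (filterS OU).
have h : (adj_to_prod X x A a : Y -> prod_topology (Ytop X x A a)) @ F -->
    (adj_to_prod X x A a c : prod_topology (Ytop X x A a)).
  apply/cvg_sup => k W; rewrite nbhsE => -[_ [[P oP <-] /= Pc] PW].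
  by apply: (filterS PW); exact: (adj_cvg_k F c k hr hq P oP Pc).
by apply: (h O); exact: open_nbhs_nbhs.
Qed.

Lemma adj_continuous {Z : topologicalType} (f : Z -> Y) :
  continuous (r \o f) -> (forall j, continuous (adj_proj j \o f)) -> continuous f.
Proof.
move=> cr cq z; apply: (adj_cvg (f @ z) (f z)) => [V hV|j V hV].
  exact: (cr z V hV).
exact: (cq j z V hV).
Qed.

Lemma adj_incl_continuous : continuous (adj_incl X x A a).
Proof.
apply: adj_continuous => [|j].
  rewrite (_ : _ \o _ = id); first by move=> y; exact: cvg_id.
  by apply/funext => y /=; rewrite adj_retr_incl.
rewrite (_ : _ \o _ = fun=> a j); first exact: cst_continuous.
by apply/funext => y /=; rewrite adj_proj_incl.
Qed.

Lemma adj_maps_converge {Z : topologicalType} (f : nat -> Z -> Y) y0 :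
  maps_converge_to (fun m => r \o f m) y0 ->
  (forall j, maps_converge_to (fun m => adj_proj j \o f m) (a j)) ->
  maps_converge_to f (adj_incl X x A a y0).
Proof.
move=> /maps_converge_toP hr hq; apply/maps_converge_toP.
(* The sets containing the images of all but finitely many maps; convergence of [f] is convergence
   of this filter. *)
pose F : set_system Y := [set S | exists N, forall m z, (N <= m)%N -> S (f m z)].
have FF : Filter F.
  split=> [|P Q [N hN] [M hM]|P Q PQ [N hN]]; first by exists 0%N.
    exists (maxn N M) => m z; rewrite geq_max => /andP[? ?].
    by split; [exact: hN|exact: hM].
  by exists N => m z Nm; apply: PQ; exact: hN.
apply: (adj_cvg F) => [V|j V]; first by rewrite adj_retr_incl => /hr.
by rewrite adj_proj_incl; move: (hq j) => /maps_converge_toP h /h.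
Qed.

(** Moves [c] within its own summand. The family [b] is realized by the result only if it stays at
    the base point wherever [c] does, as [adj_proj_update] demands. *)
Definition adj_update (c : Y) (b : forall j, A j) : Y :=
  match repr c with
  | existT None _ => c
  | existT (Some i) _ => adj_pt (existT fam (Some i) (b i))
  end.

Lemma adj_retr_update c b : r (adj_update c b) = r c.
Proof.
rewrite /adj_update; case e : (repr c) => [[i|] y] //.
by rewrite adj_retr_pt /adj_retr e.
Qed.

Lemma adj_proj_update c b j : (forall i, adj_proj i c = a i -> b i = a i) ->
  adj_proj j (adj_update c b) = b j.
Proof.
move=> h; rewrite /adj_update; case e : (repr c) => [[i|] y]; last first.
  have ce : adj_proj j c = a j by rewrite /adj_proj e.
  by rewrite ce h.
rewrite adj_proj_pt /=; case: eqtype.dfwithP => // k ik.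
by rewrite h// /adj_proj e /= eqtype.dfwith_out.
Qed.

(** Updating [f z] by the deformed coordinates leaves [r] unchanged and, by stationarity, has
    exactly the [G j] as projections, so continuity is read off from them. *)
Lemma adj_homotopy {Z : topologicalType} (f : Z -> Y) (G : forall j, (Z * I01)%type -> A j) :
  continuous f -> (forall j, continuous (G j)) ->
  (forall j z t, set_val t = 0 :> RR -> G j (z, t) = adj_proj j (f z)) ->
  (forall j z t, set_val t = 1 :> RR -> G j (z, t) = a j) ->
  (forall j z t, adj_proj j (f z) = a j -> G j (z, t) = a j) ->
  exists H : (Z * I01)%type -> Y,
  [/\ continuous H,
      forall z t, set_val t = 0 :> RR -> H (z, t) = f z,
      forall z t, set_val t = 1 :> RR -> H (z, t) = adj_incl X x A a (r (f z)),
      forall p, r (H p) = r (f p.1) &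
      forall j p, adj_proj j (H p) = G j p].
Proof.
move=> cf cG G0 G1 Ga.
pose H (p : (Z * I01)%type) := adj_update (f p.1) (fun j => G j p).
have Hr p : r (H p) = r (f p.1) by exact: adj_retr_update.
have Hq j p : adj_proj j (H p) = G j p.
  by apply: adj_proj_update => i; case: p => z t; exact: Ga.
exists H; split => //.
- apply: adj_continuous => [|j].
    rewrite (_ : _ \o _ = (r \o f) \o fst); last by apply/funext.
    move=> p; apply: continuous_comp; first exact: cvg_fst.
    by apply: continuous_comp; [exact: cf|exact: adj_retr_continuous].
  rewrite (_ : _ \o _ = G j); first exact: cG.
  by apply/funext => p; rewrite /= Hq.
- by move=> z t t0; apply: adj_ext => [|j]; rewrite ?Hr// Hq G0.
- move=> z t t1; apply: adj_ext => [|j]; first by rewrite Hr adj_retr_incl.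
  by rewrite Hq G1// adj_proj_incl.
Qed.

End AdjTopology.

(** * Stereographic projection *)

Section Stereographic.
Context {R : realType} {k : nat}.
Implicit Types (y : 'rV[R]_k) (u : 'rV[R]_k.+1).

(** Projection from the base point, whose coordinate 0 is [1]. *)
Definition stereo u : 'rV[R]_k := \row_i (u ord0 (lift ord0 i) / (1 - u ord0 ord0)).

Definition stereo_inv y : 'rV[R]_k.+1 :=
  \row_i (if unlift ord0 i is Some j then 2 * y ord0 j / (sqsum y + 1)
          else (sqsum y - 1) / (sqsum y + 1)).

Lemma sqsum1_neq0 y : sqsum y + 1 != 0.
Proof. by rewrite gt_eqF// ltr_wpDl// sqsum_ge0. Qed.

Lemma sqsum_recl u : sqsum u = u ord0 ord0 ^+ 2 + \sum_i u ord0 (lift ord0 i) ^+ 2.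
Proof. by rewrite /sqsum big_ord_recl. Qed.

Lemma sqr_le_sqsum {l : nat} (y : 'rV[R]_l) i : y ord0 i ^+ 2 <= sqsum y.
Proof.
rewrite /sqsum (bigD1 i)//= lerDl; apply: sumr_ge0 => j _; exact: sqr_ge0.
Qed.

Lemma stereo_inv0 y : stereo_inv y ord0 ord0 = (sqsum y - 1) / (sqsum y + 1).
Proof. by rewrite mxE unlift_none. Qed.

Lemma stereo_invS y j : stereo_inv y ord0 (lift ord0 j) = 2 * y ord0 j / (sqsum y + 1).
Proof. by rewrite mxE liftK. Qed.

Lemma sqsum_stereo_inv y : sqsum (stereo_inv y) = 1.
Proof.
have h := sqsum1_neq0 y.
rewrite sqsum_recl stereo_inv0.
under eq_bigr do rewrite stereo_invS mulrAC exprMn.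
by rewrite -mulr_sumr -/(sqsum y); field.
Qed.

Lemma stereo_inv_continuous : continuous stereo_inv.
Proof.
have cV : continuous (fun y => (sqsum y + 1)^-1 : R).
  move=> y; apply: (@cvgV R _ (nbhs y)); first exact: sqsum1_neq0.
  apply: (@cvgD R R^o _ (nbhs y)); last exact: cvg_cst.
  exact: sqsum_continuous.
apply: row_continuous => i; case: (unlift ord0 i) => [j|] y.
  apply: (@cvgM R _ (nbhs y)); last exact: cV.
  apply: (@cvgM R _ (nbhs y)); first exact: cvg_cst.
  exact: coord_continuous.
apply: (@cvgM R _ (nbhs y)); last exact: cV.
apply: (@cvgD R R^o _ (nbhs y)); last exact: cvg_cst.
exact: sqsum_continuous.
Qed.

Lemma stereo_cvg u : u ord0 ord0 != 1 -> {for u, continuous stereo}.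
Proof.
move=> u1; rewrite /continuous_at /stereo.
have h i : (fun v : 'rV[R]_k.+1 => v ord0 (lift ord0 i) / (1 - v ord0 ord0)) @ u -->
    u ord0 (lift ord0 i) / (1 - u ord0 ord0).
  apply: (@cvgM R _ (nbhs u)); first exact: coord_continuous.
  apply: (@cvgV R _ (nbhs u)); first by rewrite subr_eq0 eq_sym.
  apply: (@cvgB R R^o _ (nbhs u)); first exact: cvg_cst.
  exact: coord_continuous.
move=> W [P hP sP].
have hi i : \forall v \near u, 
    P ord0 i ((v : 'rV[R]_k.+1) ord0 (lift ord0 i) / (1 - v ord0 ord0)).
  by apply: (h i); have := hP ord0 i; rewrite mxE.
apply: filterS (filter_forall _ hi) => v hv; apply: sP => i j.
by rewrite mxE (ord1 i); exact: hv.
Qed.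

Lemma sqsum_stereo u : sqsum u = 1 -> u ord0 ord0 != 1 ->
  sqsum (stereo u) = (1 + u ord0 ord0) / (1 - u ord0 ord0).
Proof.
move=> su u1; have h : 1 - u ord0 ord0 != 0 by rewrite subr_eq0 eq_sym.
rewrite /sqsum; under eq_bigr do rewrite mxE exprMn.
rewrite -mulr_suml.
have -> : \sum_i u ord0 (lift ord0 i) ^+ 2 = 1 - u ord0 ord0 ^+ 2.
  by move: su; rewrite sqsum_recl => <-; rewrite addrAC subrr add0r.
by field.
Qed.

Lemma stereoK u : sqsum u = 1 -> u ord0 ord0 != 1 -> stereo_inv (stereo u) = u.
Proof.
move=> su u1; have h : 1 - u ord0 ord0 != 0 by rewrite subr_eq0 eq_sym.
have e : sqsum (stereo u) + 1 = 2 / (1 - u ord0 ord0).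
  by rewrite sqsum_stereo//; field.
have h2 : (2 : R) != 0 by rewrite pnatr_eq0.
apply/rowP => i; have [j ->|->] := unliftP ord0 i.
  by rewrite stereo_invS e mxE; field; rewrite ?h ?h2.
by rewrite stereo_inv0 e sqsum_stereo//; field; rewrite ?h ?h2.
Qed.

Lemma sphere_coord0_le1 u : sqsum u = 1 -> u ord0 ord0 <= 1.
Proof.
move=> su; have := sqr_le_sqsum u ord0; rewrite su => h.
by rewrite leNgt; apply/negP => h'; nra.
Qed.

Lemma sphere_coord0_eq1 u : sqsum u = 1 -> u ord0 ord0 = 1 ->
  u = \row_i (i == ord0)%:R.
Proof.
move=> su u1; move: (su); rewrite sqsum_recl u1 expr1n => /eqP.
rewrite -subr_eq0 addrAC subrr add0r psumr_eq0 => [/allP h|i _]; last exact: sqr_ge0.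
apply/rowP => i; rewrite mxE; have [j ->|->] := unliftP ord0 i.
  by have := h j; rewrite mem_index_enum sqrf_eq0 => /(_ isT)/eqP.
by rewrite eqxx.
Qed.

Lemma stereo_inv_far e : 0 < e -> exists N, forall y, far N y ->
  forall i, `|stereo_inv y ord0 i - (i == ord0)%:R| < e.
Proof.
(* With [S = sqsum y + 1], coordinate 0 is off by [2 / S] and the square of any other is at most
   [4 / S]; [S > B] puts the former below [e] and the latter below [e ^ 2]. *)
move=> e0; pose B := 4 / e ^+ 2 + 2 / e; pose N := (Num.truncn B).+1; exists N => y [j hj] i.
have B0 : 0 <= B by rewrite addr_ge0// divr_ge0// ?sqr_ge0// ltW.
have BN : B < N%:R by exact: truncnS_gt.
have N1 : 1 <= N%:R :> R by rewrite ler1n.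
have sN : N%:R <= sqsum y.
  apply: le_trans (sqr_le_sqsum y j); rewrite -real_normK ?num_real//.
  by rewrite expr2 (le_trans hj)// ler_peMl// (le_trans N1).
have s0 : 0 < sqsum y + 1 by rewrite ltr_wpDl// sqsum_ge0.
have sB : B < sqsum y + 1 by rewrite (lt_le_trans BN)// (le_trans sN)// lerDl.
have b1 : 2 / (sqsum y + 1) < e.
  rewrite ltr_pdivrMr// mulrC -ltr_pdivrMr//; apply: le_lt_trans sB.
  by rewrite lerDr divr_ge0// sqr_ge0.
have b2 : 4 / (sqsum y + 1) < e ^+ 2.
  rewrite ltr_pdivrMr// mulrC -ltr_pdivrMr ?exprn_gt0//; apply: le_lt_trans sB.
  by rewrite lerDl divr_ge0// ltW.
have [l ->|->] := unliftP ord0 i; last first.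
  rewrite eqxx stereo_inv0.
  have -> : (sqsum y - 1) / (sqsum y + 1) - 1 = - (2 / (sqsum y + 1)).
    by field; exact: sqsum1_neq0.
  by rewrite normrN gtr0_norm// divr_gt0.
rewrite stereo_invS (_ : (_ == _) = false)// subr0.
rewrite -(ltr_pXn2r (ltn0Sn 1)) ?nnegrE ?normr_ge0 ?(ltW e0)//.
apply: le_lt_trans b2; rewrite real_normK ?num_real// !exprMn exprVn.
have -> : 2 ^+ 2 * y ord0 l ^+ 2 / (sqsum y + 1) ^+ 2 =
    4 / (sqsum y + 1) * (y ord0 l ^+ 2 / (sqsum y + 1)).
  by field; exact: sqsum1_neq0.
rewrite ler_piMr ?divr_ge0 ?(ltW s0)// ler_pdivrMr// mul1r.
by rewrite (le_trans (sqr_le_sqsum y l))// lerDl.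
Qed.

Lemma stereo_far N : exists2 e : R, 0 < e & forall u, sqsum u = 1 ->
  u ord0 ord0 != 1 -> `|1 - u ord0 ord0| < e -> far N (stereo u).
Proof.
(* If no coordinate reaches [N], then [sqsum (stereo u) <= C]; as this sum is [2 / (1 - u 0) - 1],
   it follows that [1 - u 0 >= 2 / (C + 1)], beyond the threshold [1 / (C + 2)]. *)
pose C : R := k%:R * N%:R ^+ 2.
have C0 : 0 <= C by rewrite mulr_ge0// exprn_ge0.
have C2 : 0 < C + 2 by rewrite ltr_wpDl.
exists (C + 2)^-1; first by rewrite invr_gt0.
move=> u su u1 hu; apply: contrapT => nf.
have le1 := sphere_coord0_le1 _ su.
have lt1 : 0 < 1 - u ord0 ord0 by rewrite subr_gt0 lt_neqAle u1.
have : sqsum (stereo u) <= C.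
  rewrite /C /sqsum -[k in k%:R](card_ord k) -sum1_card natr_sum mulr_suml.
  apply: ler_sum => i _; rewrite mul1r -real_normK ?num_real//.
  rewrite lerXn2r ?nnegrE// leNgt; apply/negP => h; apply: nf; exists i; exact: ltW.
rewrite sqsum_stereo// ler_pdivrMr//; move: hu; rewrite gtr0_norm// => hu.
have : (1 - u ord0 ord0) * (C + 2) < 1.
  by rewrite -ltr_pdivlMr// div1r.
by move: C C0 {C2 hu} => C C0; nra.
Qed.

End Stereographic.

(** * Contracting sequences on cubes and on shrinking wedges *)

Lemma prod_topology_continuous {T : topologicalType} {I : Type} (K : I -> topologicalType)
  (f : T -> prod_topology K) : (forall i, continuous (fun t => f t i)) -> continuous f.
Proof.
move=> cf t; apply/cvg_sup => i W; rewrite nbhsE => -[_ [[P oP <-] /= Pt] PW].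
apply: (filterS PW); apply: (cf i t P); exact: open_nbhs_nbhs.
Qed.

Section ContractPieces.
Context {A : topologicalType} (a : A) (n : nat).
Hypotheses (a_closed : closed [set a]) (A_connected : seq_n_connected_at A a n).

(** Clamping coordinates extends the maps from the cube to all of [R^n], with value [a] outside the
    cube because clamped points lie on its boundary. *)
Lemma contract_cube (g : nat -> cube n -> A) :
  (forall m, continuous (g m)) -> (forall m z, cube_boundary n z -> g m z = a) ->
  maps_converge_to g a ->
  exists G : nat -> (cube n * I01)%type -> A,
  [/\ forall m, continuous (G m),
      forall m z (t : I01), set_val t = 0 -> G m (z, t) = g m z,
      forall m z (t : I01), set_val t = 1 -> G m (z, t) = a,
      forall m z t, g m z = a -> G m (z, t) = a &
      maps_converge_to G a].
Proof.
move=> cg gb /maps_converge_toP g0.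
pose cl (v : 'rV[RR]_n) : cube n := fun i => I01_clamp (v ord0 i).
pose row (z : cube n) : 'rV[RR]_n := \row_i set_val (z i).
have clK z : cl (row z) = z.
  by apply: functional_extensionality_dep => i; rewrite /cl mxE I01_clampK.
have ccl : continuous cl.
  apply: prod_topology_continuous => i v.
  apply: (@continuous_comp _ _ _ (fun v : 'rV[RR]_n => v ord0 i) I01_clamp).
    exact: coord_continuous.
  exact: I01_clamp_continuous.
have crow : continuous row.
  apply: row_continuous => i z.
  apply: (@continuous_comp (cube n) I01 RR (fun z => z i) set_val).
    exact: (@proj_continuous 'I_n (fun _ => I01) i).
  exact: set_val_continuous.
have [G [Gc G0 G1 Ga [Gn _]]] : exists G : nat -> 'rV[RR]_n * RR -> A,
  [/\ forall m, continuous (G m),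
      forall m z t, t <= 0 -> G m (z, t) = g m (cl z),
      forall m z t, 1 <= t -> G m (z, t) = a,
      forall m z t, g m (cl z) = a -> G m (z, t) = a &
      (forall W, nbhs a W -> exists N, forall m p, (N <= m)%N -> W (G m p)) /\
      (forall m W, nbhs a W -> exists N, forall z t, far N z -> W (G m (z, t)))].
  apply: (contract_rel a (fun m => g m \o cl) a_closed).
  - by move=> m z; apply: continuous_comp; [exact: ccl|exact: cg].
  - by move=> W /g0[N hN]; exists N => m z; exact: hN.
  (* A coordinate of absolute value at least [2] is clamped to [0] or [1]. *)
  - move=> m W aW; exists 2%N => z [i hi] /=; rewrite gb; first exact: nbhs_singleton.
    exists i; rewrite /cl I01_clampE; have [zi|zi] := leP 0 (z ord0 i).
      by right; apply: clamp01_ge1; move: hi; rewrite ger0_norm//; lra.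
    by left; apply: clamp01_le0; exact: ltW.
  - by move=> d; exact: fillable_of_connected.
exists (fun m p => G m (row p.1, set_val p.2)); split.
- move=> m p; apply: (@continuous_comp _ _ _
    (fun p : (cube n * I01)%type => (row p.1, set_val p.2 : RR)) (G m)); last exact: Gc.
  move: p; apply: continuous_pair => p.
    by apply: (@continuous_comp _ _ _ fst row); [exact: cvg_fst|exact: crow].
  apply: (@continuous_comp _ _ _ snd set_val); first exact: cvg_snd.
  exact: set_val_continuous.
- by move=> m z t t0; rewrite G0 ?clK// t0.
- by move=> m z t t1; rewrite G1// t1.
- by move=> m z t e; rewrite Ga// clK.
- by apply/maps_converge_toP => W /Gn[N hN]; exists N => m z; exact: hN.
Qed.

(** Stereographic projection puts the base point at infinity: continuity of [g m] there becomes the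
    condition at infinity of [contract_rel], and its conclusion at infinity gives back continuity of
    the homotopy at the base point. *)
Lemma contract_sphere k (g : nat -> sphere k -> A) : (k <= n)%N ->
  (forall m, continuous (g m)) -> (forall m, g m (sphere_base k) = a) ->
  maps_converge_to g a ->
  exists G : nat -> (sphere k * I01)%type -> A,
  [/\ forall m, continuous (G m),
      forall m z (t : I01), set_val t = 0 -> G m (z, t) = g m z,
      forall m z (t : I01), set_val t = 1 -> G m (z, t) = a,
      forall m z t, g m z = a -> G m (z, t) = a &
      maps_converge_to G a].
Proof.
move=> kn cg gb /maps_converge_toP g0.
have inS (y : 'rV[RR]_k) : stereo_inv y \in sphere_set k.
  by apply/mem_set; exact: sqsum_stereo_inv.
pose ist y : sphere k := @exist _ (fun v => v \in sphere_set k) _ (inS y).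
have sq (u : sphere k) : sqsum (set_val u : 'rV[RR]_k.+1) = 1.
  by have /set_mem := valP u.
pose st (u : sphere k) : 'rV[RR]_k := stereo (set_val u : 'rV[RR]_k.+1).
have neq u : u <> sphere_base k -> (set_val u : 'rV[RR]_k.+1) ord0 ord0 != 1.
  move=> ub; apply/eqP => u1; apply: ub; apply: sphere_val_inj.
  exact: (sphere_coord0_eq1 _ (sq u) u1).
have isK u : u <> sphere_base k -> ist (st u) = u.
  by move=> ub; apply: sphere_val_inj; exact: (stereoK _ (sq u) (neq _ ub)).
have cis : continuous ist.
  by apply: continuous_comp_initial; exact: stereo_inv_continuous.
have [G [Gc G0 G1 Ga [Gn Gi]]] : exists G : nat -> 'rV[RR]_k * RR -> A,
  [/\ forall m, continuous (G m),
      forall m z t, t <= 0 -> G m (z, t) = g m (ist z),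
      forall m z t, 1 <= t -> G m (z, t) = a,
      forall m z t, g m (ist z) = a -> G m (z, t) = a &
      (forall W, nbhs a W -> exists N, forall m p, (N <= m)%N -> W (G m p)) /\
      (forall m W, nbhs a W -> exists N, forall z t, far N z -> W (G m (z, t)))].
  apply: (contract_rel a (fun m => g m \o ist) a_closed).
  - by move=> m z; apply: continuous_comp; [exact: cis|exact: cg].
  - by move=> W /g0[N hN]; exists N => m z; exact: hN.
  - move=> m W aW.
    have : nbhs (sphere_base k : sphere k) [set u | W (g m u)].
      by apply: (cg m (sphere_base k) W); rewrite gb.
    rewrite nbhsE => -[_ [[O oO <-] /= Ob] OW].
    have /nbhs_ballP[e /= e0 be] : nbhs (sphere_base_vec k) O by exact: open_nbhs_nbhs.
    have [N hN] := @stereo_inv_far RR k e e0; exists N => y fy.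
    apply: OW; apply: be; split => // i j; rewrite (ord1 i) /ball /= distrC.
    by have := hN y fy j; rewrite [sphere_base_vec k _ _]mxE.
  - by move=> d dk; apply: (fillable_of_connected a n) => //; exact: leq_trans kn.
pose F m (p : (sphere k * I01)%type) :=
  if p.1 == sphere_base k then a else G m (st p.1, set_val p.2).
exists F; split.
- move=> m [u t] W; rewrite {1}/F /=; case: eqP => [->|ub] Wu.
    have [N hN] := Gi m W Wu; have [e e0 he] := @stereo_far RR k N.
    have n1 : \forall v \near (sphere_base k : sphere k),
        `|1 - (set_val v : 'rV[RR]_k.+1) ord0 ord0| < e.
      have h0 : nbhs (sphere_base_vec k ord0 ord0) [set r : RR | `|1 - r| < e].
        by rewrite mxE eqxx; apply/nbhs_ballP; exists e.
      have h1 : nbhs (sphere_base_vec k) [set v : 'rV[RR]_k.+1 | `|1 - v ord0 ord0| < e].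
        exact: (@coord_continuous RR 1 k.+1 ord0 ord0 (sphere_base_vec k) _ h0).
      exact: (set_val_continuous _ (sphere_base k) _ h1).
    have n2 : \forall p \near (sphere_base k : sphere k, t),
        `|1 - (set_val p.1 : 'rV[RR]_k.+1) ord0 ord0| < e by exact: (cvg_fst n1).
    suff : \forall p \near (sphere_base k : sphere k, t), W (F m p) by [].
    apply: filterS n2 => -[v t'] /= hv; rewrite /F /=; case: eqP => [_|vb].
      exact: nbhs_singleton.
    by apply: hN; apply: he => //; exact: neq.
  have n1 : \forall v \near u, v <> sphere_base k.
    apply: open_nbhs_nbhs; split => //; apply: closed_openC.
    exact: sphere_base_closed.
  have n1' : \forall p \near (u, t), p.1 <> sphere_base k by exact: (cvg_fst n1).
  have cE : {for (u, t), continuous (fun p : (sphere k * I01)%type => G m (st p.1, set_val p.2))}.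
    apply: (@continuous_comp _ _ _
      (fun p : (sphere k * I01)%type => (st p.1, set_val p.2 : RR)) (G m)); last exact: Gc.
    apply: continuous_pair_at.
      apply: (@continuous_comp _ _ _ fst st); first exact: cvg_fst.
      apply: (@continuous_comp _ _ _ set_val stereo); first exact: set_val_continuous.
      by apply: stereo_cvg; exact: neq.
    apply: (@continuous_comp _ _ _ snd set_val); first exact: cvg_snd.
    exact: set_val_continuous.
  have n2 : \forall p \near (u, t), W (G m (st p.1, set_val p.2)) := cE W Wu.
  suff : \forall p \near (u, t), W (F m p) by [].
  by apply: filterS2 n1' n2 => -[v t'] /= /eqP/negbTE vb; rewrite /F /= vb.
- move=> m u t t0; rewrite /F /=; case: eqP => [->|ub]; first by rewrite gb.
  by rewrite G0 ?isK// t0.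
- by move=> m u t t1; rewrite /F /=; case: eqP => // _; rewrite G1// t1.
- move=> m u t e; rewrite /F /=; case: eqP => // ub.
  by rewrite Ga// isK.
- apply/maps_converge_toP => W aW; have [N hN] := Gn _ aW; exists N => m [u t] Nm.
  by rewrite /F /=; case: eqP => _; [exact: nbhs_singleton|exact: hN].
Qed.

Lemma contract_Hk k (g : Hk k -> A) : (k <= n)%N ->
  continuous g -> g (Hk_base k) = a ->
  exists G : (Hk k * I01)%type -> A,
  [/\ continuous G,
      forall z (t : I01), set_val t = 0 -> G (z, t) = g z,
      forall z (t : I01), set_val t = 1 -> G (z, t) = a &
      forall z t, g z = a -> G (z, t) = a].
Proof.
case: k g => [|k] g kn cg gb.
  (* A sequence of points is a sequence of maps on [R^0], where the condition at infinity is
     void. *)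
  have [G [Gc G0 G1 Ga [Gn _]]] : exists G : nat -> 'rV[RR]_0 * RR -> A,
    [/\ forall m, continuous (G m),
        forall m z t, t <= 0 -> G m (z, t) = g (H0_pt m),
        forall m z t, 1 <= t -> G m (z, t) = a,
        forall m z t, g (H0_pt m) = a -> G m (z, t) = a &
        (forall W, nbhs a W -> exists N, forall m p, (N <= m)%N -> W (G m p)) /\
        (forall m W, nbhs a W -> exists N, forall z t, far N z -> W (G m (z, t)))].
    apply: (contract_rel a (fun m _ => g (H0_pt m)) a_closed).
    - by move=> m; exact: cst_continuous.
    - move=> W aW; have /H0_nbhs[_ [N hN]] : nbhs H0_base [set z | W (g z)].
        by apply: (cg H0_base W); rewrite [g _]gb.
      by exists N => m _; exact: hN.
    - by move=> m W _; exists 0%N => z [[]].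
    - by move=> d dn; apply: (fillable_of_connected a n) => //; exact: leq_trans kn.
  have [||H [cH Hb Hp]] := @H0_glue A a (fun m t => G m (0, set_val t)).
  - move=> m t; apply: (@continuous_comp _ _ _
      (fun t : I01 => (0 : 'rV[RR]_0, set_val t : RR)) (G m)); last exact: Gc.
    by move: t; apply: continuous_pair; [exact: cst_continuous|exact: set_val_continuous].
  - by apply/(maps_converge_toP (fun m (t : I01) => G m (0, set_val t))) => W /Gn[N hN];
      exists N => m z; exact: hN.
  exists H; split => //.
  - move=> z t t0; have [->|[m ->]] := H0_cases z; first by rewrite Hb [RHS]gb.
    by rewrite Hp G0// t0.
  - move=> z t t1; have [->|[m ->]] := H0_cases z; first by rewrite Hb.
    by rewrite Hp G1// t1.
  - move=> z t; have [->|[m ->]] := H0_cases z; first by rewrite Hb.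
    by rewrite Hp => e; rewrite Ga.
have gl m : g (swedge_lift k.+1 m (sphere_base k.+1)) = a by rewrite swedge_lift_base.
have [||G [Gc G0 G1 Ga Gn]] := contract_sphere k.+1
   (fun m u => g (swedge_lift k.+1 m u)) kn _ gl.
- move=> m u; apply: (@continuous_comp _ _ _
    (swedge_lift k.+1 m : _ -> shrinking_wedge k.+1) g).
    exact: swedge_lift_continuous.
  exact: cg.
- apply/(maps_converge_toP (fun m u => g (swedge_lift k.+1 m u))) => W aW.
  have /swedge_shrink[N hN] : nbhs (swedge_pt k.+1 : shrinking_wedge k.+1) [set z | W (g z)].
    by apply: (cg (swedge_pt k.+1) W); rewrite [g _]gb.
  by exists N => m u; exact: hN.
have [|H [cH HE]] := swedge_glue _ a G Gc _ Gn.
  by move=> m t; rewrite Ga.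
exists H; split => // z t.
- by move=> t0; have [m [u ->]] := swedge_surj _ z; rewrite HE G0.
- by move=> t1; have [m [u ->]] := swedge_surj _ z; rewrite HE G1.
- by have [m [u ->]] := swedge_surj _ z => e; rewrite HE Ga.
Qed.

End ContractPieces.

(** * Assembling the contractions of the coordinates *)

Theorem theorem4p11 (n : nat) (X : topologicalType) (y0 : X) (x : nat -> X)
    (A : nat -> topologicalType) (a : forall j, A j) :
  hausdorff_space X ->
  (forall j, hausdorff_space (A j)) ->
  (forall j, seq_n_connected_at (A j) (a j) n) ->
  (forall f : nat -> cube n -> Adj X x A a,
      (forall m, Omega n (Adj X x A a) (adj_incl X x A a y0) (f m)) ->
      maps_converge_to f (adj_incl X x A a y0) ->
      seq_homotopic f (fun m => adj_incl X x A a \o adj_retr X x A a \o f m)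
        (adj_incl X x A a y0)) /\
  (seq_n_connected_at X y0 n -> seq_n_connected_at (Adj X x A a) (adj_incl X x A a y0) n).
Proof.
move=> _ hA cA.
have a_closed j : closed [set a j].
  by apply: accessible_closed_set1; exact: hausdorff_accessible.
have r_cont := adj_retr_continuous X x A a.
have q_cont := adj_proj_continuous X x A a.
split=> [f Of f0|cX k kn].
  have cf m : continuous (f m) by have [] := Of m.
  have fb m z : cube_boundary n z -> f m z = adj_incl X x A a y0.
    by move=> bz; have [_] := Of m; apply; exists z.
  have q0 j : maps_converge_to (fun m => adj_proj X x A a j \o f m) (a j).
    have := maps_converge_comp f (adj_proj X x A a j) _ (q_cont j _) f0.
    by rewrite adj_proj_incl.
  have r0 : maps_converge_to (fun m => adj_retr X x A a \o f m) y0.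
    have := maps_converge_comp f (adj_retr X x A a) _ (r_cont _) f0.
    by rewrite adj_retr_incl.
  have hG j : exists G : nat -> (cube n * I01)%type -> A j,
      [/\ forall m, continuous (G m),
      forall m z (t : I01), set_val t = 0%R -> G m (z, t) = adj_proj X x A a j (f m z),
      forall m z (t : I01), set_val t = 1%R -> G m (z, t) = a j,
      forall m z t, adj_proj X x A a j (f m z) = a j -> G m (z, t) = a j &
      maps_converge_to G (a j)].
    apply: (contract_cube (a j) n (a_closed j) (cA j) (fun m => adj_proj X x A a j \o f m)) => //.
    - by move=> m z; apply: continuous_comp; [exact: cf|exact: q_cont].
    - by move=> m z bz /=; rewrite fb// adj_proj_incl.
  pose G j := projT1 (cid (hG j)).
  have GP j := projT2 (cid (hG j)).
  have hH m : exists H : (cube n * I01)%type -> Adj X x A a, _ :=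
    adj_homotopy X x A a a_closed (f m) (fun j => G j m) (cf m)
      (fun j => let: And5 h _ _ _ _ := GP j in h m)
      (fun j => let: And5 _ h _ _ _ := GP j in h m)
      (fun j => let: And5 _ _ h _ _ := GP j in h m)
      (fun j => let: And5 _ _ _ h _ := GP j in h m).
  pose H m := projT1 (cid (hH m)).
  have HP m := projT2 (cid (hH m)).
  exists H; split=> [m|]; first by case: (HP m).
  split=> [m z t t0|]; first by case: (HP m) => _ h _ _ _; exact: h.
  split=> [m z t t1|]; first by case: (HP m) => _ _ h _ _; exact: h.
  apply: adj_maps_converge => //.
    apply/maps_converge_toP => W; move: r0 => /maps_converge_toP h /h[N hN].
    exists N => m p Nm /=; case: (HP m) => _ _ _ -> _; exact: hN.
  move=> j; apply/maps_converge_toP => W.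
  have [_ _ _ _ /maps_converge_toP h] := GP j => /h[N hN].
  by exists N => m p Nm /=; case: (HP m) => _ _ _ _ ->; exact: hN.
apply/based_htpy_classes_singleton => f [cf fb].
have hG j : exists G : (Hk k * I01)%type -> A j,
    [/\ continuous G,
    forall z (t : I01), set_val t = 0%R -> G (z, t) = adj_proj X x A a j (f z),
    forall z (t : I01), set_val t = 1%R -> G (z, t) = a j &
    forall z t, adj_proj X x A a j (f z) = a j -> G (z, t) = a j].
  apply: (contract_Hk (a j) n (a_closed j) (cA j) k (adj_proj X x A a j \o f) kn).
    by move=> z; apply: continuous_comp; [exact: cf|exact: q_cont].
  by rewrite /= fb adj_proj_incl.
pose G j := projT1 (cid (hG j)).
have GP j := projT2 (cid (hG j)).
have [H [cH H0 H1 Hr Hq]] := adj_homotopy X x A a a_closed f G cf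
  (fun j => let: And4 h _ _ _ := GP j in h)
  (fun j => let: And4 _ h _ _ := GP j in h)
  (fun j => let: And4 _ _ h _ := GP j in h)
  (fun j => let: And4 _ _ _ h := GP j in h).
(* [f] is deformed into [X] by a homotopy that is based because coordinates at their base points do
   not move; then [r \o f] is contracted inside [X]. *)
apply: (@based_homotopic_trans _ _ _ _ _ (adj_incl X x A a \o (adj_retr X x A a \o f))).
  exists H; split => //; split => //; split => // t.
  apply: adj_ext => [|j]; first by rewrite Hr /= fb.
  rewrite Hq adj_proj_incl; case: (GP j) => _ _ _; apply.
  by rewrite fb adj_proj_incl.
have /based_htpy_classes_singleton/(_ (adj_retr X x A a \o f)) := cX k kn.
case.
  split; last by rewrite /= fb adj_retr_incl.
  by move=> z; apply: continuous_comp; [exact: cf|exact: r_cont].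
move=> K [cK [K0 [K1 Kb]]]; exists (adj_incl X x A a \o K); split.
  move=> p; apply: continuous_comp; first exact: cK.
  exact: adj_incl_continuous.
split=> [z t t0|]; first by rewrite /= K0.
by split=> [z t t1|t] /=; [rewrite (K1 _ _ t1)|rewrite Kb].
Qed.
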